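(* Let $p$ be a prime and $G$ a group. Then $G$ has twisted $p$-periodic cohomology if and only if there exist an $n>1$ and an exact sequence of $\mathbb{Z}/p\mathbb{Z}[G]$-modules $$\epsilon:\quad 0\to\mathbb{Z}/p\mathbb{Z}\to A\to P_{n-2}\to\cdots\to P_0\to\mathbb{Z}/p\mathbb{Z}\to 0$$ with $P_i$ projective for $0\le i\le n-2$ and $\operatorname{proj.dim}_{\mathbb{Z}/p\mathbb{Z}[G]}(A)<\infty$, such that $[\epsilon]\in \operatorname{Ext}^n_{\mathbb{Z}/p\mathbb{Z}[G]}(\mathbb{Z}/p\mathbb{Z},\mathbb{Z}/p\mathbb{Z})=H^n(G,\mathbb{Z}/p\mathbb{Z})$ is $\omega$-$p$-integral for some $\omega:G\to\hat{\mathbb{Z}}_p^\times$. Moreover, $G$ has $p$-periodic cohomology if and only if there is such an $\epsilon$ with $[\epsilon]$ $p$-integral.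
   Context: Let $\hat{\mathbb{Z}}_p$ be the $p$-adic integers; $\mathbb{Z}/p\mathbb{Z}$ carries the trivial $G$-action. For a homomorphism $\omega:G\to\hat{\mathbb{Z}}_p^\times$, $\hat{\mathbb{Z}}_p(\omega)$ denotes $\hat{\mathbb{Z}}_p$ with $G$-action via $\omega$, and for a $\mathbb{Z}G$-module $M$, $M_\omega:=M\otimes\hat{\mathbb{Z}}_p(\omega)$ with diagonal $G$-action (if $M$ is $p$-torsion of finite exponent, $M_\omega$ is $M$ with $g$ acting by $m\mapsto\omega(g)\,gm$). $G$ has twisted $p$-periodic cohomology if there are $k>0$, a homomorphism $\omega:G\to\hat{\mathbb{Z}}_p^\times$ and a class $e_\omega\in H^n(G,\hat{\mathbb{Z}}_p(\omega))$ for some $n>0$ such that $e_\omega\cup-:H^i(G,M)\to H^{i+n}(G,M_\omega)$ is an isomorphism for all $i\ge k$ and all $p$-torsion $\mathbb{Z}G$-modules $M$ of finite exponent. If $\omega$ can be chosen trivial, $G$ has $p$-periodic cohomology. A class $x\in H^n(G,\mathbb{Z}/p\mathbb{Z})$ is $\omega$-$p$-integral, for a homomorphism $\omega:G\to\hat{\mathbb{Z}}_p^\times$, if the action via $\omega$ is trivial on $\hat{\mathbb{Z}}_p/p\hat{\mathbb{Z}}_p=\mathbb{Z}/p\mathbb{Z}$ and $x$ lies in the image of the coefficient homomorphism $H^n(G,\hat{\mathbb{Z}}_p(\omega))\to H^n(G,\mathbb{Z}/p\mathbb{Z})$. It is $p$-integral if this holds with $\omega$ trivial. *)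

(* Defs.v *)
From HB Require Import structures.
From mathcomp Require Import all_boot all_order all_algebra.
From mathcomp Require Import boolp functions.

Set Implicit Arguments.
Unset Strict Implicit.
Unset Printing Implicit Defensive.

Import GRing.Theory.
Local Open Scope ring_scope.
Local Open Scope quotient_scope.


(* 'Z_q has q elements only for 1 < q, hence the levels p ^ n.+1. *)
Section PadicRing.
Variable p : nat.

Definition Zp_red (n : nat) (a : 'Z_(p ^ n.+2)) : 'Z_(p ^ n.+1) :=
  (a : nat)%:R.

Record padic := Padic {
  padic_level :> forall n, 'Z_(p ^ n.+1);
  padic_coherent : forall n, Zp_red (padic_level n.+1) = padic_level n }.

Lemma padic_eq (x y : padic) : (forall n, x n = y n) -> x = y.
Proof.
case: x y => [x xP] [y yP] /= exy.
have {}exy : x = y by apply: functional_extensionality_dep.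
by rewrite exy in xP *; congr Padic; apply: Prop_irrelevance.
Qed.

HB.instance Definition _ := gen_eqMixin padic.
HB.instance Definition _ := gen_choiceMixin padic.

Lemma Zp_trunc_dvd n :
  ((Zp_trunc (p ^ n.+1)).+2 %| (Zp_trunc (p ^ n.+2)).+2)%N.
Proof.
case: p => [|[|q]]; rewrite ?exp0n ?exp1n //.
have h k : (1 < q.+2 ^ k.+1)%N by rewrite -{1}(expn0 q.+2) ltn_exp2l.
by rewrite !Zp_cast // dvdn_exp2l.
Qed.

Lemma natr_modn_dvd (q d a : nat) : ((Zp_trunc d).+2 %| q)%N ->
  (a %% q)%N%:R = a%:R :> 'Z_d.
Proof. by move=> dq; apply: val_inj; rewrite !Zp_nat /= modn_dvdm. Qed.

Lemma Zp_redD n : {morph @Zp_red n : x y / x + y}.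
Proof. by move=> x y; rewrite /Zp_red natr_modn_dvd ?natrD // Zp_trunc_dvd. Qed.

Lemma Zp_redM n : {morph @Zp_red n : x y / x * y}.
Proof. by move=> x y; rewrite /Zp_red natr_modn_dvd ?natrM // Zp_trunc_dvd. Qed.


Lemma Zp_red0 n : Zp_red (0 : 'Z_(p ^ n.+2)) = 0.
Proof. by []. Qed.

Lemma Zp_redN n : {morph @Zp_red n : x / - x}.
Proof.
move=> x; apply/eqP; rewrite -subr_eq0 opprK -Zp_redD addrC subrr.
by rewrite Zp_red0.
Qed.

Fact padic0_subproof n : Zp_red (0 : 'Z_(p ^ n.+2)) = 0.
Proof. by []. Qed.
Fact padic1_subproof n : Zp_red (1 : 'Z_(p ^ n.+2)) = 1.
Proof. by []. Qed.
Fact padicD_subproof (x y : padic) n : Zp_red (x n.+1 + y n.+1) = x n + y n.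
Proof. by rewrite Zp_redD !padic_coherent. Qed.
Fact padicN_subproof (x : padic) n : Zp_red (- x n.+1) = - x n.
Proof. by rewrite Zp_redN !padic_coherent. Qed.
Fact padicM_subproof (x y : padic) n : Zp_red (x n.+1 * y n.+1) = x n * y n.
Proof. by rewrite Zp_redM !padic_coherent. Qed.

Definition padic0 := Padic padic0_subproof.
Definition padic1 := Padic padic1_subproof.
Definition padic_add x y := Padic (padicD_subproof x y).
Definition padic_opp x := Padic (padicN_subproof x).
Definition padic_mul x y := Padic (padicM_subproof x y).

Fact padic_addA : associative padic_add.
Proof. by move=> x y z; apply: padic_eq => n /=; rewrite addrA. Qed.
Fact padic_addC : commutative padic_add.
Proof. by move=> x y; apply: padic_eq => n /=; rewrite addrC. Qed.
Fact padic_add0 : left_id padic0 padic_add.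
Proof. by move=> x; apply: padic_eq => n /=; rewrite add0r. Qed.
Fact padic_addN : left_inverse padic0 padic_opp padic_add.
Proof. by move=> x; apply: padic_eq => n /=; rewrite addNr. Qed.
Fact padic_mulA : associative padic_mul.
Proof. by move=> x y z; apply: padic_eq => n /=; rewrite mulrA. Qed.
Fact padic_mulC : commutative padic_mul.
Proof. by move=> x y; apply: padic_eq => n /=; rewrite mulrC. Qed.
Fact padic_mul1 : left_id padic1 padic_mul.
Proof. by move=> x; apply: padic_eq => n /=; rewrite mul1r. Qed.
Fact padic_mulD : left_distributive padic_mul padic_add.
Proof. by move=> x y z; apply: padic_eq => n /=; rewrite mulrDl. Qed.
Fact padic_1neq0 : padic1 != padic0.
Proof. by apply/eqP => /(congr1 (fun x : padic => x 0)) /eqP; rewrite oner_eq0. Qed.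

HB.instance Definition _ := GRing.isZmodule.Build padic
  padic_addA padic_addC padic_add0 padic_addN.
HB.instance Definition _ := GRing.Zmodule_isComNzRing.Build padic
  padic_mulA padic_mulC padic_mul1 padic_mulD padic_1neq0.

Definition padic_is_unit : pred padic := fun x => `[< exists y, y * x = 1 >].
Definition padic_inv (x : padic) : padic :=
  if pselect (exists y, y * x = 1) is left h then projT1 (cid h) else x.

Fact padic_mulV : {in padic_is_unit, left_inverse 1 padic_inv *%R}.
Proof.
move=> x /asboolP h; rewrite /padic_inv; case: pselect => // h'.
exact: projT2 (cid h').
Qed.
Fact padic_unitP (x y : padic) : y * x = 1 -> padic_is_unit x.
Proof. by move=> yx; apply/asboolP; exists y. Qed.
Fact padic_inv_out : {in [predC padic_is_unit], padic_inv =1 id}.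
Proof.
move=> x /asboolP h; rewrite /padic_inv.
by case: pselect.
Qed.
HB.instance Definition _ := GRing.ComNzRing_hasMulInverse.Build padic
  padic_mulV padic_unitP padic_inv_out.

Definition padic_modp (x : padic) : 'F_p := (x 0 : nat)%:R.

End PadicRing.

Section PadicModp.
Variable p : nat.

Fact pdiv_trunc_dvd : ((Zp_trunc (pdiv p)).+2 %| (Zp_trunc (p ^ 1)).+2)%N.
Proof.
rewrite expn1; case: p => [|[|q]] //.
have h : (1 < pdiv q.+2)%N by rewrite prime_gt1 // pdiv_prime.
by rewrite !Zp_cast // pdiv_dvd.
Qed.

Lemma padic_modpD : {morph @padic_modp p : x y / x + y}.
Proof.
by move=> x y; rewrite /padic_modp natr_modn_dvd ?natrD // pdiv_trunc_dvd.
Qed.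

Fact padic_modp_nmod : nmod_morphism (@padic_modp p).
Proof. by split=> //; apply: padic_modpD. Qed.
HB.instance Definition _ :=
  GRing.isNmodMorphism.Build (padic p) 'F_p (@padic_modp p) padic_modp_nmod.

Lemma padic_modpM : {morph @padic_modp p : x y / x * y}.
Proof.
by move=> x y; rewrite /padic_modp natr_modn_dvd ?natrM // pdiv_trunc_dvd.
Qed.

End PadicModp.


(* A ZG-module: an abelian group with an additive action of [G]. *)
Record zgMod (G : groupType) := ZgMod {
  zg_car :> zmodType;
  zg_act : G -> zg_car -> zg_car;
  zg_act1 : forall m, zg_act 1%g m = m;
  zg_actM : forall g h m, zg_act (g * h)%g m = zg_act g (zg_act h m);
  zg_actD : forall g, {morph zg_act g : m n / m + n} }.

Notation "g ** m" := (zg_act g m) (at level 40, left associativity).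

Record zgHom (G : groupType) (M N : zgMod G) := ZgHom {
  zg_fun :> {additive M -> N};
  zg_funG : forall g m, zg_fun (g ** m) = g ** zg_fun m }.

(* A module over the group ring R[G]: an R-module with an R-linear action. *)
Record rgMod (R : nzRingType) (G : groupType) := RgMod {
  rg_car :> lmodType R;
  rg_act : G -> rg_car -> rg_car;
  rg_act1 : forall m, rg_act 1%g m = m;
  rg_actM : forall g h m, rg_act (g * h)%g m = rg_act g (rg_act h m);
  rg_actD : forall g, {morph rg_act g : m n / m + n};
  rg_actZ : forall g a, {morph rg_act g : m / a *: m} }.

Definition rg_zg (R : nzRingType) (G : groupType) (M : rgMod R G) : zgMod G :=
  ZgMod (@rg_act1 R G M) (@rg_actM R G M) (@rg_actD R G M).

Record rgHom (R : nzRingType) (G : groupType) (M N : rgMod R G) := RgHom {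
  rg_fun :> {linear M -> N};
  rg_funG : forall g m, rg_fun (rg_act g m) = rg_act g (rg_fun m) }.

Definition onto (A B : Type) (f : A -> B) := forall y, exists x, f x = y.

Definition projective (R : nzRingType) (G : groupType) (P : rgMod R G) :=
  forall (M N : rgMod R G) (f : rgHom M N) (h : rgHom P N),
    onto f -> exists k : rgHom P M, forall x, f (k x) = h x.

(* ... -> C_1 -> C_0 -> M; exactness is imposed separately. *)
Record augmented (R : nzRingType) (G : groupType) (M : rgMod R G) := Augmented {
  aug_mod :> nat -> rgMod R G;
  aug_d : forall i, rgHom (aug_mod i.+1) (aug_mod i);
  aug_eps : rgHom (aug_mod 0) M }.

Section Augmented.
Variables (R : nzRingType) (G : groupType) (M : rgMod R G) (C : augmented M).

Definition aug_ker i : C i -> Prop :=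
  match i return C i -> Prop with
  | 0 => fun x => aug_eps C x = 0
  | j.+1 => fun x => aug_d C j x = 0
  end.

Definition aug_exact i := forall x : C i, aug_ker x <-> exists y, aug_d C i y = x.

End Augmented.

Definition projdim_le (R : nzRingType) (G : groupType) (A : rgMod R G) (d : nat) :=
  exists Q : augmented A,
    [/\ forall i, projective (Q i), onto (aug_eps Q), forall i, aug_exact Q i
      & forall i, (d < i)%N -> forall x : Q i, x = 0].

Section Trivial.
Variables (R : nzRingType) (G : groupType).
Let act (g : G) (m : R^o) := m.
Fact triv_act1 m : act 1%g m = m. Proof. by []. Qed.
Fact triv_actM g h m : act (g * h)%g m = act g (act h m). Proof. by []. Qed.
Fact triv_actD g : {morph act g : m n / m + n}. Proof. by []. Qed.
Fact triv_actZ g a : {morph act g : m / a *: m}. Proof. by []. Qed.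
Definition triv_mod : rgMod R G := RgMod triv_act1 triv_actM triv_actD triv_actZ.
End Trivial.

Section Twist.
Variables (p : nat) (G : groupType).

Record padic_char := PadicChar {
  pchar_fun :> G -> padic p;
  pchar_unit : forall g, pchar_fun g \is a GRing.unit;
  pcharM : forall g h, pchar_fun (g * h)%g = pchar_fun g * pchar_fun h }.

Lemma pchar1 (w : padic_char) : w 1%g = 1.
Proof. by apply: (mulrI (pchar_unit w 1%g)); rewrite -pcharM mulg1 mulr1. Qed.

Fact triv_char_unit (g : G) : (1 : padic p) \is a GRing.unit.
Proof. exact: unitr1. Qed.
Fact triv_charM (g h : G) : 1 = 1 * 1 :> padic p.
Proof. by rewrite mulr1. Qed.
Definition triv_char : padic_char := PadicChar triv_char_unit triv_charM.

Section ZpTwist.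
Variable w : padic_char.
Let act (g : G) (a : padic p) := w g * a.
Fact zpt_act1 a : act 1%g a = a. Proof. by rewrite /act pchar1 mul1r. Qed.
Fact zpt_actM g h a : act (g * h)%g a = act g (act h a).
Proof. by rewrite /act pcharM mulrA. Qed.
Fact zpt_actD g : {morph act g : a b / a + b}.
Proof. by move=> a b; rewrite /act mulrDr. Qed.
Definition Zp_twist : zgMod G := ZgMod zpt_act1 zpt_actM zpt_actD.
End ZpTwist.

(* A p-torsion ZG-module of finite exponent: killed by some power of p. *)
Record ptMod := PtMod {
  pt_mod :> zgMod G;
  pt_exp : nat;
  pt_kill : forall m : pt_mod, m *+ p ^ pt_exp = 0 }.

(* The action of Z_p on such a module M.  The isomorphism of M (x) Z_p with M
   is m (x) x |-> x m, and x acts through any Z/p^k killing M. *)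
Definition pt_scale (M : ptMod) (x : padic p) (m : M) : M :=
  m *+ (x (pt_exp M) : nat).

Hypothesis p_pr : prime p.

Lemma pt_mod_expn (M : ptMod) (m : M) k :
  m *+ (k %% (Zp_trunc (p ^ (pt_exp M).+1)).+2)%N = m *+ k.
Proof.
rewrite Zp_cast; last first.
  by rewrite -(expn0 p) ltn_exp2l // prime_gt1.
rewrite [in RHS](divn_eq k (p ^ (pt_exp M).+1)) mulrnDr mulnC expnSr.
by rewrite -mulnA mulrnA pt_kill mul0rn add0r.
Qed.

Lemma pt_scaleDl (M : ptMod) x y (m : M) :
  pt_scale (x + y) m = pt_scale x m + pt_scale y m.
Proof. by rewrite /pt_scale /= pt_mod_expn mulrnDr. Qed.

Lemma pt_scaleDr (M : ptMod) x (m n : M) :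
  pt_scale x (m + n) = pt_scale x m + pt_scale x n.
Proof. by rewrite /pt_scale mulrnDl. Qed.

Lemma pt_scaleM (M : ptMod) x y (m : M) :
  pt_scale (x * y) m = pt_scale x (pt_scale y m).
Proof. by rewrite /pt_scale /= pt_mod_expn mulnC mulrnA. Qed.

Lemma pt_scale1 (M : ptMod) (m : M) : pt_scale 1 m = m.
Proof. by rewrite /pt_scale /=. Qed.

Fact pt_scale_nmodr (M : ptMod) (x : padic p) :
  nmod_morphism (@pt_scale M x).
Proof. by split=> [|m n]; rewrite ?pt_scaleDr // /pt_scale mul0rn. Qed.

Fact pt_scale_nmodl (M : ptMod) (m : M) : nmod_morphism (@pt_scale M ^~ m).
Proof. by split=> // x y; rewrite pt_scaleDl. Qed.

Lemma pt_scaleMzr (M : ptMod) x (m : M) z :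
  pt_scale x (m *~ z) = pt_scale x m *~ z.
Proof.
pose f := GRing.isNmodMorphism.Build M M (@pt_scale M x) (pt_scale_nmodr M x).
pose F : {additive M -> M} := HB.pack (@pt_scale M x) f.
exact: (raddfMz F).
Qed.

Lemma pt_scaleMzl (M : ptMod) x (m : M) z :
  pt_scale (x *~ z) m = pt_scale x m *~ z.
Proof.
pose f := GRing.isNmodMorphism.Build (padic p) M (@pt_scale M ^~ m)
  (pt_scale_nmodl m).
pose F : {additive padic p -> M} := HB.pack (@pt_scale M ^~ m) f.
exact: (raddfMz F).
Qed.

Lemma pt_scale_sumr (M : ptMod) x (I : Type) r (P : pred I) (F : I -> M) :
  pt_scale x (\sum_(j <- r | P j) F j) = \sum_(j <- r | P j) pt_scale x (F j).
Proof.
by apply: (big_morph _ (pt_scaleDr x)); case: (pt_scale_nmodr M x).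
Qed.

Lemma pt_scale_suml (M : ptMod) (m : M) (I : Type) r (P : pred I)
    (F : I -> padic p) :
  pt_scale (\sum_(j <- r | P j) F j) m = \sum_(j <- r | P j) pt_scale (F j) m.
Proof.
apply: (big_morph (fun x => pt_scale x m)) => [x y|]; first exact: pt_scaleDl.
by case: (pt_scale_nmodl m).
Qed.

Lemma zg_actMn (M : zgMod G) g (m : M) k : g ** (m *+ k) = (g ** m) *+ k.
Proof.
have act0 : g ** (0 : M) = 0.
  by apply: (addrI (g ** 0)); rewrite -zg_actD !addr0.
by elim: k => [|k IHk]; rewrite ?mulr0n // !mulrS zg_actD IHk.
Qed.

Section PtTwist.
Variables (M : ptMod) (w : padic_char).
Let act (g : G) (m : M) := pt_scale (w g) (g ** m).
Fact ptt_act1 m : act 1%g m = m.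
Proof. by rewrite /act pchar1 pt_scale1 zg_act1. Qed.
Fact ptt_actM g h m : act (g * h)%g m = act g (act h m).
Proof. by rewrite /act pcharM pt_scaleM zg_actM {3}/pt_scale zg_actMn. Qed.
Fact ptt_actD g : {morph act g : m n / m + n}.
Proof. by move=> m n; rewrite /act zg_actD pt_scaleDr. Qed.
Definition pt_twist : zgMod G := ZgMod ptt_act1 ptt_actM ptt_actD.
End PtTwist.

End Twist.


(* Homogeneous cochains: an equivariant f : G^{n+1} -> M is a ZG-linear map on
   the n-th term Z[G^{n+1}] of the standard resolution of Z. *)
Notation cochain n G M := (('I_n.+1 -> G%type) -> zg_car M).

Section Cohomology.
Variables (G : groupType) (M : zgMod G).

Definition equivariant n (f : cochain n G M) :=
  forall g x, f (fun i => g * x i)%g = g ** f x.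

(* [x \o lift j] omits the j-th entry of [x]. *)
Definition delta n (f : cochain n G M) : cochain n.+1 G M :=
  fun x => \sum_(j < n.+2) f (x \o lift j) *~ (-1) ^+ j.

Lemma deltaB n (f h : cochain n G M) : delta (f - h) = delta f - delta h.
Proof.
apply/funext => x; rewrite /delta.
rewrite [RHS](_ : _ = delta f x - delta h x) // /delta -sumrB.
by apply: eq_bigr => j _; rewrite -mulrzBl.
Qed.

Lemma zg_act0 g : g ** (0 : M) = 0.
Proof. by apply: (addrI (g ** 0)); rewrite -zg_actD !addr0. Qed.

Lemma zg_actN g (m : M) : g ** (- m) = - (g ** m).
Proof. by apply/eqP; rewrite -subr_eq0 opprK -zg_actD addNr zg_act0. Qed.

Lemma zg_actB g (m n : M) : g ** (m - n) = g ** m - g ** n.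
Proof. by rewrite zg_actD zg_actN. Qed.

Lemma zg_actMz g (m : M) z : g ** (m *~ z) = (g ** m) *~ z.
Proof.
case: z => k; first exact: zg_actMn.
by rewrite NegzE !mulrNz zg_actN -!pmulrn zg_actMn.
Qed.

Lemma equivariant0 n : equivariant (0 : cochain n G M).
Proof. by move=> g x; rewrite zg_act0. Qed.

Lemma equivariantB n (f h : cochain n G M) :
  equivariant f -> equivariant h -> equivariant (f - h).
Proof.
by move=> ef eh g x; rewrite [in RHS]/GRing.add /= zg_actB -ef -eh.
Qed.

Lemma delta0 n : delta (0 : cochain n G M) = 0.
Proof. by rewrite -(subrr 0) deltaB subrr. Qed.

Definition cocycle_pred n : {pred cochain n G M} :=
  fun f => `[< equivariant f /\ delta f = 0 >].

Fact cocycle_zmod n : zmod_closed (@cocycle_pred n).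
Proof.
split=> [|f h /asboolP[ef df] /asboolP[eh dh]]; apply/asboolP; split.
- exact: equivariant0.
- exact: delta0.
- exact: equivariantB.
- by rewrite deltaB df dh subrr.
Qed.
HB.instance Definition _ n :=
  GRing.isZmodClosed.Build (cochain n G M) (@cocycle_pred n) (@cocycle_zmod n).

Record cocycle n := Cocycle {
  cocycle_val :> cochain n G M;
  cocycleP : cocycle_val \in @cocycle_pred n }.
HB.instance Definition _ n := [isSub for @cocycle_val n].
HB.instance Definition _ n := [Choice of cocycle n by <:].
HB.instance Definition _ n := [SubChoice_isSubZmodule of cocycle n by <:].

Lemma cocycle_valB n (f h : cocycle n) :
  cocycle_val (f - h) = cocycle_val f - cocycle_val h.
Proof. exact: (raddfB (val : cocycle n -> cochain n G M)). Qed.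

Lemma cocycle_valD n (f h : cocycle n) :
  cocycle_val (f + h) = cocycle_val f + cocycle_val h.
Proof. exact: (raddfD (val : cocycle n -> cochain n G M)). Qed.

Lemma cocycle_val0 n : cocycle_val (0 : cocycle n) = 0.
Proof. exact: (raddf0 (val : cocycle n -> cochain n G M)). Qed.

Definition is_coboundary n : cochain n G M -> Prop :=
  match n return cochain n G M -> Prop with
  | 0 => fun f => f = 0
  | m.+1 => fun f => exists2 h : cochain m G M, equivariant h & f = delta h
  end.

Definition coboundary n : {pred cocycle n} := fun f => `[< is_coboundary f >].

Fact coboundary_zmod n : zmod_closed (@coboundary n).
Proof.
split=> [|f h /asboolP bf /asboolP bh]; apply/asboolP.
  rewrite cocycle_val0; case: n => [|n] //=.
  exists 0; [exact: equivariant0 | by rewrite delta0].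
rewrite cocycle_valB; case: n f h bf bh => [|n] f h /=.
  by move=> -> ->; rewrite subrr.
move=> [f' ef ->] [h' eh ->].
by exists (f' - h'); [apply: equivariantB | rewrite deltaB].
Qed.
HB.instance Definition _ n :=
  GRing.isZmodClosed.Build (cocycle n) (@coboundary n) (@coboundary_zmod n).

Definition cohomology n : zmodType := Quotient.quot (@coboundary n).

Definition cls n (f : cocycle n) : cohomology n :=
  \pi_(Quotient.quot (@coboundary n)) f.

Definition cls_repr n (x : cohomology n) : cocycle n :=
  repr (x : Quotient.quot (@coboundary n)).

Lemma cls_reprK n : cancel (@cls_repr n) (@cls n).
Proof. exact: reprK. Qed.

Lemma clsD n (f h : cocycle n) : cls (f + h) = cls f + cls h.
Proof. exact: (raddfD (\pi_(Quotient.quot (@coboundary n)))). Qed.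

Lemma cls_eqP n (f h : cocycle n) :
  cls f = cls h <-> is_coboundary (cocycle_val f - cocycle_val h).
Proof.
rewrite -cocycle_valB; split=> [/eqP|B]; first by rewrite -Quotient.idealrBE => /asboolP.
by apply/eqP; rewrite -Quotient.idealrBE; apply/asboolP.
Qed.

End Cohomology.

Section CohomMap.
Variables (G : groupType) (M N : zgMod G) (f : zgHom M N).

Fact cohom_map_subproof n (c : cocycle M n) :
  (fun x => f (c x)) \in @cocycle_pred G N n.
Proof.
have /asboolP[ec dc] := cocycleP c; apply/asboolP; split.
  by move=> g x; rewrite ec zg_funG.
apply/funext => x; have : f (delta c x) = 0 by rewrite dc; apply: raddf0.
rewrite /delta raddf_sum => fd0; rewrite -[RHS]fd0.
by apply: eq_bigr => j _; rewrite raddfMz.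
Qed.

Definition cohom_map n (x : cohomology M n) : cohomology N n :=
  cls (Cocycle (cohom_map_subproof (cls_repr x))).

Lemma cohom_map_cls n (c : cocycle M n) :
  cohom_map (cls c) = cls (Cocycle (cohom_map_subproof c)).
Proof.
rewrite /cohom_map; set c' := cls_repr _.
have /cls_eqP : cls c' = cls c by rewrite cls_reprK.
move=> hc; apply/cls_eqP => /=.
have -> : ((fun x => f (c' x)) : cochain n G N) - (fun x => f (c x)) =
    (fun x => f ((cocycle_val c' - cocycle_val c) x)).
  by apply/funext => x; apply/esym/raddfB.
move: (cocycle_val c' - cocycle_val c) hc; case: n c c' => [|n] _ _ b /=.
  by move=> ->; apply/funext => x; apply: raddf0.
move=> [h eh ->]; exists (fun x => f (h x)) => [g x|].
  by rewrite eh zg_funG.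
apply/funext => x; rewrite /delta raddf_sum.
by apply: eq_bigr => j _; rewrite raddfMz.
Qed.

End CohomMap.

Section CupProduct.
Variables (p : nat) (p_pr : prime p) (G : groupType) (M : ptMod p G).
Variable w : padic_char p G.

(* The Alexander-Whitney formula, with values in M (x) Z_p(w) = M_w. *)
Definition cup_cochain n i (a : cochain n G (Zp_twist w)) (f : cochain i G M) :
    cochain (i + n)%N G (pt_twist p_pr M w) :=
  fun x => pt_scale (a (fun k => x (inord k))) (f (fun k => x (inord (n + k)%N))).

Definition res n (y : nat -> G) : 'I_n.+1 -> G := fun k => y k.
Arguments res : clear implicits.

Lemma resE n (x : 'I_n.+1 -> G) : x = res n (fun k => x (inord k)).
Proof. by apply/funext => k; rewrite /res inord_val. Qed.

Lemma delta_res (N : zgMod G) n (f : cochain n G N) y :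
  delta f (res n.+1 y) =
  \sum_(0 <= j < n.+2) f (res n (fun k => y (bump j k))) *~ (-1) ^+ j.
Proof. by rewrite big_mkord; apply: eq_bigr. Qed.

Lemma cup_res n i a f y :
  @cup_cochain n i a f (res (i + n)%N y) =
  pt_scale (a (res n y)) (f (res i (fun k => y (n + k)%N))).
Proof.
rewrite /cup_cochain /res; congr (pt_scale (a _) (f _)); apply/funext => k.
  by rewrite inordK // ltnS (leq_trans (leq_ord k)) // leq_addl.
by rewrite inordK // ltnS addnC leq_add2r leq_ord.
Qed.

Lemma delta_cup n i a f y :
  delta (@cup_cochain n i a f) (res (i + n)%N.+1 y) =
  pt_scale (delta a (res n.+1 y)) (f (res i (fun k => y (n.+1 + k)%N))) +
  pt_scale (a (res n y)) (delta f (res i.+1 (fun k => y (n + k)%N)))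
    *~ (-1) ^+ n.
Proof.
rewrite [LHS]delta_res.
under eq_bigr => j _ do rewrite cup_res.
have le_n : (n.+1 <= (i + n).+2)%N by rewrite ltnS -addSn leq_addl.
rewrite (big_cat_nat _ le_n) //=.
rewrite !delta_res (big_nat_recr n.+1) //= (big_nat_recl i.+1) //=.
set A := a (res n y); set F := f (res i (fun k => y (n.+1 + k)%N)).
have -> : a (res n (fun k => y (bump n.+1 k))) = A.
  congr a; apply/funext => k; rewrite /res /bump.
  by rewrite ltnNge -ltnS ltn_ord.
have -> : f (res i (fun k => y (n + bump 0 k)%N)) = F.
  by congr f; apply/funext => k; rewrite /res /bump /= addnCA.
rewrite pt_scaleDl // pt_scaleDr pt_scaleMzl // expr0 mulr1z mulrzDl.
rewrite exprS mulN1r mulrNz addrA addrNK.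
rewrite pt_scale_suml // pt_scale_sumr // mulrz_suml; congr (_ + _).
  apply: eq_big_nat => j /andP[_ lt_j]; rewrite pt_scaleMzl //.
  congr (pt_scale _ (f _) *~ _); apply/funext => k; rewrite /res /bump.
  by rewrite (leq_trans _ (leq_addr k n)).
have -> : (i + n).+2 = (i.+1 + n.+1)%N by rewrite addSn addnS.
rewrite -{1}[n.+1]add0n big_addn addnK.
apply: eq_big_nat => j _; rewrite pt_scaleMzr // -mulrzA -exprD.
rewrite addSnnS; congr (pt_scale (a _) (f _) *~ _).
  apply/funext => k; rewrite /res /bump.
  by rewrite leqNgt ltn_addl.
apply/funext => k; rewrite /res /bump; congr y.
by rewrite -addSnnS (addnC j.+1) leq_add2l addnCA.
Qed.


Lemma cup_equivariant n i a f :
  equivariant a -> equivariant f -> equivariant (@cup_cochain n i a f).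
Proof.
move=> ea ef g x; rewrite {1}/cup_cochain ea ef /= pt_scaleM // /pt_scale.
by rewrite zg_actMn -!mulrnA mulnC.
Qed.

Fact cup_cocycle_subproof n i (a : cocycle (Zp_twist w) n) (f : cocycle M i) :
  cup_cochain a f \in @cocycle_pred G (pt_twist p_pr M w) (i + n).
Proof.
have /asboolP[ea da] := cocycleP a; have /asboolP[ef df] := cocycleP f.
apply/asboolP; split; first exact: cup_equivariant.
apply/funext => x; rewrite (resE x) delta_cup da df.
have -> : (0 : cochain n.+1 G (Zp_twist w)) (res n.+1 (fun k => x (inord k))) = 0 by [].
by rewrite (pt_scale_nmodr _ _).1 (pt_scale_nmodl p_pr _).1 mul0rz addr0.
Qed.

Definition cup_cocycle n i (a : cocycle (Zp_twist w) n) (f : cocycle M i) :=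
  Cocycle (cup_cocycle_subproof a f).

Definition cup n i (e : cohomology (Zp_twist w) n) (x : cohomology M i) :
    cohomology (pt_twist p_pr M w) (i + n)%N :=
  cls (cup_cocycle (cls_repr e) (cls_repr x)).

Lemma is_coboundary_intro (N : zgMod G) k m (f : cochain k G N) : k = m.+1 ->
  (exists2 h : cochain m G N, equivariant h &
     forall y, f (res k y) = delta h (res m.+1 y)) -> is_coboundary f.
Proof.
move=> ek; subst k => -[h eh fh]; exists h => //.
by apply/funext => x; rewrite (resE x) fh.
Qed.

Lemma cup_coboundaryr n i (a : cocycle (Zp_twist w) n) (f : cochain i G M) :
  is_coboundary f -> is_coboundary (cup_cochain a f).
Proof.
have /asboolP[ea da] := cocycleP a.
case: i f => [|i] f.
  move=> /= ->; have -> : cup_cochain a (0 : cochain 0 G M) = 0.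
    by apply/funext => x; rewrite /cup_cochain (pt_scale_nmodr _ _).1.
  case: n a ea da => [|n] a ea da //=.
  exists 0; [exact: equivariant0 | by rewrite delta0].
move=> [h eh ->]; apply: (@is_coboundary_intro _ _ (i + n)%N) => //.
exists (fun x => cup_cochain a h x *~ (-1) ^+ n).
  move=> g x; rewrite cup_equivariant //.
  exact: (esym (zg_actMz _ _ _)).
move=> y; rewrite (cup_res a (delta h)).
have -> : delta (fun x => cup_cochain a h x *~ (-1) ^+ n) (res (i + n)%N.+1 y) =
    delta (cup_cochain a h) (res (i + n)%N.+1 y) *~ (-1) ^+ n.
  rewrite /delta mulrz_suml; apply: eq_bigr => j _.
  by rewrite -!mulrzA mulrC.
rewrite delta_cup da.
have -> : (0 : cochain n.+1 G (Zp_twist w)) (res n.+1 y) = 0 by [].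
rewrite (pt_scale_nmodl p_pr _).1 add0r -mulrzA -exprD addnn -mul2n.
by rewrite exprM sqrrN expr1n mulr1z.
Qed.

Lemma cup_coboundaryl n i (a : cochain n G (Zp_twist w)) (f : cocycle M i) :
  is_coboundary a -> is_coboundary (cup_cochain a f).
Proof.
have /asboolP[ef df] := cocycleP f.
case: n a => [|n] a.
  move=> /= ->; have -> : cup_cochain (0 : cochain 0 G (Zp_twist w)) f = 0.
    by apply/funext => x; rewrite /cup_cochain (pt_scale_nmodl p_pr _).1.
  case: i f ef df => [|i] f ef df //=.
  exists 0; [exact: equivariant0 | by rewrite delta0].
move=> [b eb ->]; apply: (@is_coboundary_intro _ _ (i + n)%N).
  by rewrite addnS.
exists (cup_cochain b f); first exact: cup_equivariant.
move=> y; rewrite (cup_res (delta b)) delta_cup df.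
have -> : (0 : cochain i.+1 G M) (res i.+1 (fun k => y (n + k)%N)) = 0 by [].
by rewrite (pt_scale_nmodr _ _).1 mul0rz addr0.
Qed.

Lemma is_coboundaryD (N : zgMod G) n (f h : cochain n G N) :
  is_coboundary f -> is_coboundary h -> is_coboundary (f + h).
Proof.
case: n f h => [|n] f h /=; first by move=> -> ->; rewrite addr0.
move=> [b eb ->] [c ec ->]; exists (b - (0 - c)).
  by do 2!apply: equivariantB => //; apply: equivariant0.
by rewrite !deltaB delta0 sub0r opprK.
Qed.

Lemma cup_cls n i (a : cocycle (Zp_twist w) n) (f : cocycle M i) :
  cup (cls a) (cls f) = cls (cup_cocycle a f).
Proof.
rewrite /cup; set a' := cls_repr _; set f' := cls_repr _.
have /cls_eqP ha : cls a' = cls a by rewrite cls_reprK.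
have /cls_eqP hf : cls f' = cls f by rewrite cls_reprK.
apply/cls_eqP => /=.
have -> : cup_cochain a' f' - cup_cochain a f =
    cup_cochain (cocycle_val a' - cocycle_val a) f' +
    cup_cochain a (cocycle_val f' - cocycle_val f).
  apply/funext => x; rewrite /cup_cochain.
  pose u (k : 'I_n.+1) := x (inord k).
  pose v (k : 'I_i.+1) := x (inord (n + k)%N).
  rewrite [LHS](_ : _ = pt_scale (a' u) (f' v) - pt_scale (a u) (f v)) //.
  rewrite [RHS](_ : _ = pt_scale (a' u - a u) (f' v) +
    pt_scale (a u) (f' v - f v)) //.
  rewrite pt_scaleDl // pt_scaleDr -(mulN1r (a u)) -addrA; congr (_ + _).
  have -> : pt_scale (-1 * a u) (f' v) = - pt_scale (a u) (f' v).
    rewrite mulN1r; apply/eqP; rewrite -subr_eq0 opprK -pt_scaleDl // addNr.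
    by rewrite (pt_scale_nmodl p_pr _).1.
  rewrite addrA addNr add0r; apply/esym/eqP; rewrite -subr_eq0 opprK.
  by rewrite -pt_scaleDr addNr (pt_scale_nmodr _ _).1.
by apply: is_coboundaryD; [apply: cup_coboundaryl | apply: cup_coboundaryr].
Qed.

Lemma cupD n i (e : cohomology (Zp_twist w) n) :
  {morph (@cup n i e) : x y / x + y}.
Proof.
move=> x y; rewrite -(cls_reprK e) -(cls_reprK x) -(cls_reprK y).
rewrite -clsD !cup_cls -clsD; congr cls; apply: val_inj.
by apply/funext => z; apply: pt_scaleDr.
Qed.

End CupProduct.


Section Periodicity.
Variables (p : nat) (p_pr : prime p) (G : groupType).

Definition periodic_via (w : padic_char p G) :=
  exists (k n : nat) (e : cohomology (Zp_twist w) n),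
    [/\ (0 < k)%N, (0 < n)%N
      & forall i, (k <= i)%N -> forall M : ptMod p G,
          bijective (@cup p p_pr G M w n i e)].

Definition twisted_p_periodic := exists w : padic_char p G, periodic_via w.

Definition p_periodic := periodic_via (triv_char p G).

End Periodicity.


Section Extensions.
Variables (p : nat) (G : groupType).

Notation FpG1 := (triv_mod 'F_p G).
Notation Hp n := (cohomology (rg_zg FpG1) n).

(* An exact sequence 0 -> F_p -> A -> P_m -> ... -> P_0 -> F_p -> 0 of
   F_p[G]-modules, of length n = m + 2.  The terms of [ext_P] of index greater
   than m are unconstrained and play no role. *)
Record extension (m : nat) := Extension {
  ext_P : augmented FpG1;
  ext_A : rgMod 'F_p G;
  ext_d : rgHom ext_A (ext_P m);
  ext_i : rgHom FpG1 ext_A;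
  ext_onto : onto (aug_eps ext_P);
  ext_exact : forall i, (i < m)%N -> aug_exact ext_P i;
  ext_exactP : forall x : ext_P m,
    @aug_ker _ _ _ ext_P m x <-> exists a, ext_d a = x;
  ext_exactA : forall a, ext_d a = 0 <-> exists c, ext_i c = a;
  ext_inj : injective ext_i }.

(* [x] is the Yoneda class of [E]: there is a chain map from the standard
   resolution Z[G^{i+1}] to [E], lifting the identity (up to Z -> F_p) on the
   right, whose component in degree n = m + 2 is a cocycle of class [x].  Such
   chain maps exist by exactness of [E], and any two are homotopic, so this
   determines [x]; other sign conventions change [x] to - x. *)
Definition ext_class (m : nat) (E : extension m) (x : Hp m.+2) :=
  exists (phi : forall i, cochain i G (rg_zg (ext_P E i)))
         (phiA : cochain m.+1 G (rg_zg (ext_A E)))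
         (c : cocycle (rg_zg FpG1) m.+2),
    [/\ (forall i, equivariant (phi i)) /\ equivariant phiA,
        forall y, aug_eps (ext_P E) (phi 0%N y) = 1,
        forall i, (i < m)%N ->
          forall y, aug_d (ext_P E) i (phi i.+1 y) = delta (phi i) y,
        forall y, ext_d E (phiA y) = delta (phi m) y
      & (forall y, ext_i E (c y) = delta phiA y) /\ cls c = x].

Definition trivial_modp (w : padic_char p G) :=
  forall g, padic_modp (w g) = 1.

Section ModpHom.
Variables (w : padic_char p G) (w1 : trivial_modp w).
Fact modp_homG g (a : Zp_twist w) :
  padic_modp (g ** a) = g ** (padic_modp a : rg_zg FpG1).
Proof. by rewrite padic_modpM w1 mul1r. Qed.
Definition modp_hom : zgHom (Zp_twist w) (rg_zg FpG1) := 
  @ZgHom G (Zp_twist w) (rg_zg FpG1) (@padic_modp p) modp_homG.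
End ModpHom.

Definition omega_p_integral (w : padic_char p G) n (x : Hp n) :=
  exists (w1 : trivial_modp w) (y : cohomology (Zp_twist w) n),
    cohom_map (modp_hom w1) y = x.

Definition p_integral n (x : Hp n) := omega_p_integral (triv_char p G) x.

End Extensions.

(* Main.v *)
(* Write k = F_p and let F be the standard free resolution of k over k[G].  For a
   cocycle c : F_n -> k, cup product with c is precomposition with a chain map
   cap : F_{n+*} -> F_* lifting c.

   From the extension to periodicity: let Q -> A be a finite projective
   resolution.  Splicing P_0, ..., P_m with the cone of a lift F -> Q of k -> A
   gives a second projective resolution of k, which agrees with F shifted by n in
   high degrees; the projection to F is homotopic to cap under the homotopy
   equivalence, so the cup product is an isomorphism in high degrees for modules
   killed by p.  The five lemma for p M -> M -> M / p M extends this to all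
   p-torsion modules of finite exponent: surjectivity in degrees >= d together
   with injectivity in degrees > d is stable under extensions, so the bound does
   not grow with the exponent.

   From periodicity to the extension: the 2(p-1)-th power of the periodicity
   class has a character trivial mod p and degree at least 2.  Let c be its
   reduction and A the pushout of F_{n-1} <- im (F_n -> F_{n-1}) -> k.  The cone of
   cap is a projective resolution of A, and its Ext groups vanish in high degrees
   because cup product with c is an isomorphism; hence A has finite projective
   dimension. *)

Require Import Defs.
From HB Require Import structures.
From mathcomp Require Import freeg.
From mathcomp Require Import all_boot all_order all_algebra.
From mathcomp Require Import finfield.
From mathcomp Require Import boolp functions.

Set Implicit Arguments.
Unset Strict Implicit.
Unset Printing Implicit Defensive.

Import GRing.Theory.
Local Open Scope ring_scope.
Local Open Scope quotient_scope.

(** * Modules over a group ring *)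

(** Apart from the two ends of the argument, no cohomology class appears: an isomorphism in
    cohomology is unfolded into two factorization statements about cocycles, seen as equivariant
    cochains or as homomorphisms out of the standard resolution. Two obstacles shape the comparison
    of resolutions. The sequence given by an extension is exact in the sense of [augmented] only
    below [m], and at [m] its cycles come from [A], which need not be projective. Comparison maps
    and homotopies are therefore built up to [m], then continued by hand through the composite Q_0
    -> A -> P_m. Moreover, cup product with a cocycle of degree n commutes with differentials only
    up to (-1)^n; the sign is moved into the differential of one of the complexes, which preserves
    exactness. Triviality of the character mod p makes the twist invisible on modules killed by p,
    so that there the cup product with the p-adic class is the cup product with its reduction [c],
    and arguments over F_p[G] apply. *)

Section Hom.
Variables (R : nzRingType) (G : groupType).
Implicit Types M N L : rgMod R G.

Definition is_hom M N (f : M -> N) :=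
  linear f /\ forall g x, f (rg_act g x) = rg_act g (f x).

Definition mk_hom M N (f : M -> N) (hf : is_hom f) : rgHom M N :=
  let L : {linear M -> N} := HB.pack f (GRing.isLinear.Build R M N *:%R f hf.1)
  in RgHom (rg_fun := L) hf.2.

Section Theory.
Variables (M N : rgMod R G) (f : rgHom M N).
Lemma hom0 : f 0 = 0. Proof. exact: raddf0. Qed.
Lemma homD x y : f (x + y) = f x + f y. Proof. exact: raddfD. Qed.
Lemma homN x : f (- x) = - f x. Proof. exact: raddfN. Qed.
Lemma homB x y : f (x - y) = f x - f y. Proof. exact: raddfB. Qed.
Lemma homZ a x : f (a *: x) = a *: f x. Proof. exact: linearZ. Qed.
Lemma homMz x z : f (x *~ z) = f x *~ z. Proof. exact: raddfMz. Qed.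
Lemma rg_act0 g : rg_act g (0 : M) = 0.
Proof. by apply: (addrI (rg_act g 0)); rewrite -rg_actD !addr0. Qed.
Lemma rg_actN g (x : M) : rg_act g (- x) = - rg_act g x.
Proof. exact: (@zg_actN G (rg_zg M)). Qed.
Lemma rg_actMz g (x : M) z : rg_act g (x *~ z) = rg_act g x *~ z.
Proof. exact: (@zg_actMz G (rg_zg M)). Qed.
End Theory.

Fact idh_subproof M : is_hom (@id M). Proof. by []. Qed.
Definition idh M := mk_hom (@idh_subproof M).

Fact cmph_subproof M N L (f : rgHom N L) (h : rgHom M N) :
  is_hom (fun x => f (h x)).
Proof. by split=> [a x y|g x]; rewrite ?linearP // !rg_funG. Qed.
Definition cmph M N L (f : rgHom N L) (h : rgHom M N) :=
  mk_hom (cmph_subproof f h).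

Fact zeroh_subproof M N : is_hom (fun _ : M => 0 : N).
Proof. by split=> [a x y|g x]; rewrite ?scaler0 ?addr0 // rg_act0. Qed.
Definition zeroh M N := mk_hom (@zeroh_subproof M N).
Arguments zeroh {M N}.

Fact subh_subproof M N (f h : rgHom M N) : is_hom (fun x => f x - h x).
Proof.
split=> [a x y|g x]; last by rewrite !rg_funG -rg_actN -rg_actD.
by rewrite /= !(homD, homZ) scalerBr opprD addrACA.
Qed.
Definition subh M N (f h : rgHom M N) := mk_hom (subh_subproof f h).

Fact addh_subproof M N (f h : rgHom M N) : is_hom (fun x => f x + h x).
Proof.
split=> [a x y|g x]; last by rewrite !rg_funG -rg_actD.
by rewrite !linearP scalerDr addrACA.
Qed.
Definition addh M N (f h : rgHom M N) := mk_hom (addh_subproof f h).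

Fact mzh_subproof M N (f : rgHom M N) z : is_hom (fun x => f x *~ z).
Proof.
split=> [a x y|g x]; last by rewrite rg_funG rg_actMz.
by rewrite linearP mulrzDl scalerMzr.
Qed.
Definition mzh M N (f : rgHom M N) z := mk_hom (mzh_subproof f z).

Section Sum.
Variables M N : rgMod R G.
Let act g (x : M * N) : M * N := (rg_act g x.1, rg_act g x.2).
Fact sum_act1 x : act 1%g x = x.
Proof. by case: x => x y; rewrite /act /= !rg_act1. Qed.
Fact sum_actM g h x : act (g * h)%g x = act g (act h x).
Proof. by rewrite /act !rg_actM. Qed.
Fact sum_actD g : {morph act g : x y / x + y}.
Proof. by move=> x y; rewrite /act /= !rg_actD. Qed.
Fact sum_actZ g a : {morph act g : x / a *: x}.
Proof. by move=> x; rewrite /act /= !rg_actZ. Qed.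
Definition sum_mod : rgMod R G :=
  @RgMod R G (M * N)%type act sum_act1 sum_actM sum_actD sum_actZ.

Fact fsth_subproof : is_hom (fun x : sum_mod => x.1 : M). Proof. by []. Qed.
Definition fsth := mk_hom fsth_subproof.
Fact sndh_subproof : is_hom (fun x : sum_mod => x.2 : N). Proof. by []. Qed.
Definition sndh := mk_hom sndh_subproof.
End Sum.

Fact pairh_subproof L M N (f : rgHom L M) (h : rgHom L N) :
  is_hom (fun x => (f x, h x) : sum_mod M N).
Proof.
split=> [a x y|g x]; last by rewrite !rg_funG.
by rewrite !linearP.
Qed.
Definition pairh L M N (f : rgHom L M) (h : rgHom L N) : rgHom L (sum_mod M N) :=
  mk_hom (pairh_subproof f h).

Section Zero.
Let act (g : G) (x : 'rV[R]_0) := x.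
Fact zero_act1 x : act 1%g x = x. Proof. by []. Qed.
Fact zero_actM g h x : act (g * h)%g x = act g (act h x). Proof. by []. Qed.
Fact zero_actD g : {morph act g : x y / x + y}. Proof. by []. Qed.
Fact zero_actZ g a : {morph act g : x / a *: x}. Proof. by []. Qed.
Definition zero_mod : rgMod R G :=
  RgMod zero_act1 zero_actM zero_actD zero_actZ.
Lemma zero_modE (x : zero_mod) : x = 0.
Proof. exact: thinmx0. Qed.
End Zero.

Lemma idhE M (x : M) : idh M x = x. Proof. by []. Qed.
Lemma cmphE M N L (f : rgHom N L) (h : rgHom M N) x : cmph f h x = f (h x).
Proof. by []. Qed.
Lemma zerohE M N (x : M) : (zeroh : rgHom M N) x = 0. Proof. by []. Qed.
Lemma addhE M N (f h : rgHom M N) x : addh f h x = f x + h x.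
Proof. by []. Qed.
Lemma subhE M N (f h : rgHom M N) x : subh f h x = f x - h x.
Proof. by []. Qed.
Lemma mzhE M N (f : rgHom M N) z x : mzh f z x = f x *~ z. Proof. by []. Qed.
Lemma pairhE L M N (f : rgHom L M) (h : rgHom L N) x : pairh f h x = (f x, h x).
Proof. by []. Qed.
Lemma fsthE M N (x : sum_mod M N) : fsth M N x = x.1. Proof. by []. Qed.
Lemma sndhE M N (x : sum_mod M N) : sndh M N x = x.2. Proof. by []. Qed.
Definition homE := (idhE, cmphE, zerohE, addhE, subhE, mzhE, pairhE, fsthE, sndhE).

End Hom.
Arguments zeroh {R G M N}.

(** * Quotient modules *)

Section ZgQuotient.
Variables (G : groupType) (M : zgMod G) (S : M -> Prop).
Hypotheses (S0 : S 0) (SB : forall x y, S x -> S y -> S (x - y)).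
Hypothesis (SG : forall g x, S x -> S (g ** x)).

Definition quo_pred : {pred M} := fun x => `[< S x >].
Fact quo_zmod : zmod_closed quo_pred.
Proof.
by split=> [|x y /asboolP sx /asboolP sy]; apply/asboolP => //; apply: SB.
Qed.
HB.instance Definition _ := GRing.isZmodClosed.Build M quo_pred quo_zmod.

Definition zq_car : zmodType := Quotient.quot quo_pred.
Definition zq_pi (x : M) : zq_car := \pi_(Quotient.quot quo_pred) x.
Definition zq_repr (q : zq_car) : M := repr (q : Quotient.quot quo_pred).

Lemma zq_reprK q : zq_pi (zq_repr q) = q. Proof. exact: reprK. Qed.
Lemma zq_piP x y : zq_pi x = zq_pi y <-> S (x - y).
Proof.
split=> [/eqP|s]; first by rewrite -Quotient.idealrBE => /asboolP.
by apply/eqP; rewrite -Quotient.idealrBE; apply/asboolP.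
Qed.
Lemma zq_piD x y : zq_pi (x + y) = zq_pi x + zq_pi y.
Proof. exact: (raddfD (\pi_(Quotient.quot quo_pred))). Qed.

Let act g (q : zq_car) := zq_pi (g ** zq_repr q).
Lemma zq_act_pi g x : act g (zq_pi x) = zq_pi (g ** x).
Proof.
by apply/zq_piP; rewrite -zg_actB; apply/SG/zq_piP; rewrite zq_reprK.
Qed.
Fact zq_act1 q : act 1%g q = q.
Proof. by rewrite -[q]zq_reprK zq_act_pi zg_act1. Qed.
Fact zq_actM g h q : act (g * h)%g q = act g (act h q).
Proof. by rewrite -[q]zq_reprK !zq_act_pi zg_actM. Qed.
Fact zq_actD g : {morph act g : q r / q + r}.
Proof.
move=> q r; rewrite -[q]zq_reprK -[r]zq_reprK -zq_piD !zq_act_pi.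
by rewrite zg_actD zq_piD.
Qed.
Definition zg_quo : zgMod G := ZgMod zq_act1 zq_actM zq_actD.

End ZgQuotient.

Section ZgHom.
Variable G : groupType.
Implicit Types M N L : zgMod G.
Definition is_zhom M N (f : M -> N) :=
  {morph f : x y / x + y} /\ forall g x, f (g ** x) = g ** f x.
Fact zhom_nmod M N (f : M -> N) : is_zhom f -> nmod_morphism f.
Proof.
case=> fD _; split=> //; apply: (addrI (f 0)).
by rewrite -fD !addr0.
Qed.
Definition mk_zhom M N (f : M -> N) (hf : is_zhom f) : zgHom M N :=
  let F : {additive M -> N} :=
    HB.pack f (GRing.isNmodMorphism.Build M N f (zhom_nmod hf))
  in ZgHom (zg_fun := F) hf.2.
End ZgHom.

Section RgQuotient.
Variables (R : nzRingType) (G : groupType) (M : rgMod R G) (S : M -> Prop).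
Hypotheses (S0 : S 0) (SB : forall x y, S x -> S y -> S (x - y)).
Hypothesis (SG : forall g x, S x -> S (rg_act g x)).
Hypothesis (SZ : forall a x, S x -> S (a *: x)).

Let Q := @zg_quo G (rg_zg M) S S0 SB SG.
Let pi : M -> Q := @zq_pi G (rg_zg M) S S0 SB.
Let rp : Q -> M := @zq_repr G (rg_zg M) S S0 SB.
Let rpK q : pi (rp q) = q. Proof. exact: zq_reprK. Qed.
Let piP x y : pi x = pi y <-> S (x - y). Proof. exact: zq_piP. Qed.
Let piD x y : pi (x + y) = pi x + pi y. Proof. exact: zq_piD. Qed.
Let scl a (q : Q) := pi (a *: rp q).
Let scl_pi a x : scl a (pi x) = pi (a *: x).
Proof. by apply/piP; rewrite -scalerBr; apply/SZ/piP; rewrite rpK. Qed.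
Fact rq_scaleA a b q : scl a (scl b q) = scl (a * b) q.
Proof. by rewrite -[q]rpK !scl_pi scalerA. Qed.
Fact rq_scale1 : left_id 1 scl.
Proof. by move=> q; rewrite -[q]rpK !scl_pi scale1r. Qed.
Fact rq_scaleDr : right_distributive scl +%R.
Proof. by move=> a q r; rewrite -[q]rpK -[r]rpK -piD !scl_pi scalerDr piD. Qed.
Fact rq_scaleDl q : {morph scl^~ q : a b / a + b}.
Proof. by move=> a b; rewrite -[q]rpK !scl_pi scalerDl piD. Qed.

Definition rq_car : lmodType R :=
  HB.pack (zg_car Q) (GRing.Zmodule_isLmodule.Build R (zg_car Q)
    rq_scaleA rq_scale1 rq_scaleDr rq_scaleDl).
Fact rq_actZ g a (q : Q) : zg_act g (scl a q) = scl a (zg_act g q).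
Proof.
have actE x : zg_act g (pi x) = pi (rg_act g x) by exact: zq_act_pi.
by rewrite -[q]rpK actE !scl_pi actE rg_actZ.
Qed.
Definition rg_quo : rgMod R G :=
  @RgMod R G rq_car (@zg_act G Q) (@zg_act1 G Q) (@zg_actM G Q) (@zg_actD G Q)
    rq_actZ.

Fact quo_pi_subproof : is_hom (pi : M -> rg_quo).
Proof.
split=> [a x y|g x]; last by rewrite [RHS]zq_act_pi.
rewrite [LHS]piD; congr (_ + _); exact/esym/scl_pi.
Qed.
Definition quo_pi : rgHom M rg_quo := mk_hom quo_pi_subproof.
Definition quo_repr : rg_quo -> M := rp.
Lemma quo_reprK q : quo_pi (quo_repr q) = q. Proof. exact: rpK. Qed.
Lemma quo_piP x y : quo_pi x = quo_pi y <-> S (x - y). Proof. exact: piP. Qed.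
Lemma quo_pi0 x : quo_pi x = 0 <-> S x.
Proof. by rewrite -(hom0 quo_pi) quo_piP subr0. Qed.

Section Factor.
Variables (N : rgMod R G) (f : rgHom M N) (fS : forall x, S x -> f x = 0).
Lemma quo_factorE x : f (quo_repr (quo_pi x)) = f x.
Proof.
by apply/eqP; rewrite -subr_eq0 -homB; apply/eqP/fS/quo_piP; rewrite quo_reprK.
Qed.
Fact quo_factor_subproof : is_hom (fun q => f (quo_repr q)).
Proof.
split=> [a q r|g q].
  rewrite -[q]quo_reprK -[r]quo_reprK -linearP !quo_factorE; exact: linearP.
by rewrite -[q]quo_reprK -rg_funG !quo_factorE rg_funG.
Qed.
Definition quo_factor : rgHom rg_quo N := mk_hom quo_factor_subproof.
Lemma quo_factor_pi x : quo_factor (quo_pi x) = f x.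
Proof. exact: quo_factorE. Qed.
End Factor.
End RgQuotient.

(** * Projective modules and lifting *)

Section Projective.
Variables (R : nzRingType) (G : groupType).
Implicit Types M N P : rgMod R G.

Section Image.
Variables (M N : rgMod R G) (f : rgHom M N).
Let S x := f x = 0.
Fact ker0 : S 0. Proof. exact: hom0. Qed.
Fact kerB x y : S x -> S y -> S (x - y).
Proof. by rewrite /S homB => -> ->; rewrite subrr. Qed.
Fact kerG g x : S x -> S (rg_act g x).
Proof. by rewrite /S rg_funG => ->; rewrite rg_act0. Qed.
Fact kerZ a x : S x -> S (a *: x).
Proof. by rewrite /S homZ => ->; rewrite scaler0. Qed.
(* The coimage M / ker f, used in place of the submodule im f. *)
Definition coim : rgMod R G := rg_quo ker0 kerB kerG kerZ.
Definition coim_pi : rgHom M coim := quo_pi ker0 kerB kerG kerZ.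
Definition coim_inj : rgHom coim N := quo_factor ker0 kerB kerG kerZ (fun x => id).
Lemma coim_injE x : coim_inj (coim_pi x) = f x.
Proof. exact: quo_factor_pi. Qed.
Lemma coim_piP x y : coim_pi x = coim_pi y <-> f x = f y.
Proof.
rewrite quo_piP /S homB; split=> [/eqP|->]; last by rewrite subrr.
by rewrite subr_eq0 => /eqP.
Qed.
Lemma coim_onto : onto coim_pi.
Proof. by move=> q; exists (quo_repr q); apply: quo_reprK. Qed.
End Image.

(** Differentials are not onto, so lifting is needed along any map whose image contains that of [h].
    Arbitrary preimages under [f] become well defined in the coimage, so [h] turns into a
    homomorphism to it, and [coim_pi] is onto. *)
Lemma proj_lift P M N (f : rgHom M N) (h : rgHom P N) : projective P ->
  (forall x, exists y, f y = h x) -> exists k : rgHom P M, forall x, f (k x) = h x.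
Proof.
move=> pP hf; pose s x := projT1 (cid (hf x)).
have sE x : f (s x) = h x by rewrite /s; case: cid.
have h'P : is_hom (fun x => coim_pi f (s x)).
  split=> [a x y|g x].
    by rewrite -linearP; apply/coim_piP; rewrite linearP !sE linearP.
  by rewrite -rg_funG; apply/coim_piP; rewrite rg_funG !sE rg_funG.
have [k kE] := pP _ _ (coim_pi f) (mk_hom h'P) (@coim_onto _ _ f).
exists k => x; rewrite -sE; exact/coim_piP/kE.
Qed.

Lemma projective_retract P M (i : rgHom P M) (r : rgHom M P) :
  (forall x, r (i x) = x) -> projective M -> projective P.
Proof.
move=> ri pM A B f h fo; have [k kE] := pM _ _ f (cmph h r) fo.
by exists (cmph k i) => x; rewrite /= kE /= ri.
Qed.

Lemma projective_sum M N : projective M -> projective N -> projective (sum_mod M N).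
Proof.
move=> pM pN A B f h fo.
have [k kE] := pM _ _ f (cmph h (pairh (idh M) zeroh)) fo.
have [l lE] := pN _ _ f (cmph h (pairh zeroh (idh N))) fo.
exists (addh (cmph k (fsth M N)) (cmph l (sndh M N))) => -[x y] /=.
rewrite homD kE lE /=.
transitivity (h ((x, 0) + (0, y) : sum_mod M N)); first exact/esym/homD.
congr (h _).
by rewrite /GRing.add /= /add_pair /= addr0 add0r.
Qed.

Lemma projective_zero : projective (zero_mod R G).
Proof.
move=> A B f h fo; exists zeroh => x.
by rewrite [x]zero_modE !hom0.
Qed.

End Projective.

(** * The standard resolution *)

Section Cochains.
Variables (G : groupType) (M : zgMod G).

Lemma delta_equivariant n (f : cochain n G M) :
  equivariant f -> equivariant (delta f).
Proof.
move=> ef g x; rewrite /delta (big_morph _ (@zg_actD G M g) (zg_act0 M g)).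
by apply: eq_bigr => j _; rewrite zg_actMz -ef.
Qed.

Lemma delta_additive (N : zgMod G) (h : M -> N) n (f : cochain n G M) y :
  {morph h : a b / a + b} -> h (delta f y) = delta (fun x => h (f x)) y.
Proof.
move=> hD.
have h0 : h 0 = 0 by apply: (addrI (h 0)); rewrite -hD !addr0.
pose H : {additive M -> N} :=
  HB.pack h (GRing.isNmodMorphism.Build M N h (conj h0 hD)).
rewrite /delta [LHS](raddf_sum H); apply: eq_bigr => j _; exact: (raddfMz H).
Qed.

Lemma deltaD n (f h : cochain n G M) : delta (f + h) = delta f + delta h.
Proof. by rewrite -[h]opprK deltaB -[- - h]sub0r deltaB delta0 sub0r. Qed.

Lemma deltaN n (f : cochain n G M) : delta (- f) = - delta f.
Proof. by rewrite -[- f]sub0r deltaB delta0 sub0r. Qed.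

Lemma equivariantD n (f h : cochain n G M) :
  equivariant f -> equivariant h -> equivariant (f + h).
Proof.
move=> ef eh; rewrite -[h]opprK -[- h]sub0r.
by do 2!apply: equivariantB => //; apply: equivariant0.
Qed.

Lemma equivariantN n (f : cochain n G M) : equivariant f -> equivariant (- f).
Proof. by move=> ef; rewrite -sub0r; apply: equivariantB => //; apply: equivariant0. Qed.

Definition consg n (g : G) (y : 'I_n.+1 -> G) : 'I_n.+2 -> G :=
  fun i => oapp y g (unlift ord0 i).

Lemma consg0 n g (y : 'I_n.+1 -> G) : consg g y ord0 = g.
Proof. by rewrite /consg unlift_none. Qed.

Lemma consgS n g (y : 'I_n.+1 -> G) i : consg g y (lift ord0 i) = y i.
Proof. by rewrite /consg liftK. Qed.

Lemma consg_eta n (y : 'I_n.+2 -> G) : consg (y ord0) (y \o lift ord0) = y.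
Proof.
apply/funext => i; case: (unliftP ord0 i) => [j ->|->]; last by rewrite consg0.
by rewrite consgS.
Qed.

Lemma consg_lift0 n g (y : 'I_n.+1 -> G) : consg g y \o lift ord0 = y.
Proof. by apply/funext => i /=; rewrite consgS. Qed.

Lemma consg_liftS n g (y : 'I_n.+2 -> G) i :
  consg g y \o lift (lift ord0 i) = consg g (y \o lift i).
Proof.
apply/funext => k /=; case: (unliftP ord0 k) => [j ->|->].
  rewrite consgS /= -(consgS g y); congr (consg _ _ _); apply: val_inj => /=.
  by rewrite /bump /= !add1n ltnS addnS.
have -> : lift (lift ord0 i) ord0 = ord0 :> 'I_n.+3 by apply: val_inj.
by rewrite !consg0.
Qed.

Lemma consg_lift1 g (y : 'I_1 -> G) i : consg g y \o lift (lift ord0 i) = fun=> g.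
Proof.
apply/funext => k /=; have -> : lift (lift ord0 i) k = ord0.
  by apply: val_inj; rewrite [i]ord1 [k]ord1.
exact: consg0.
Qed.

(** Dual form of the contraction of the standard resolution that prepends a fixed vertex: ds + sd =
    1. *)
Lemma delta_consg n g (f : cochain n.+1 G M) y :
  delta f (consg g y) = f y - delta (fun x => f (consg g x)) y.
Proof.
rewrite {1}/delta big_ord_recl expr0 mulr1z consg_lift0; congr (_ + _).
rewrite /delta -sumrN; apply: eq_bigr => i _.
by rewrite consg_liftS lift0 exprS mulN1r mulrNz.
Qed.

Lemma delta_consg0 g (f : cochain 0 G M) y :
  delta f (consg g y) = f y - f (fun=> g).
Proof.
rewrite /delta big_ord_recl expr0 mulr1z consg_lift0; congr (_ + _).
by rewrite big_ord1 consg_lift1 lift0 expr1 mulrN1z.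
Qed.

(** Instead of cancelling faces in pairs, contract at the first vertex: [delta_consg] reduces the
    claim for [f] to the claim for the cochain of lower degree obtained by fixing the first entry.
    In degree 0 the coboundary of a constant remains, which vanishes. *)
Lemma delta_delta n (f : cochain n G M) : delta (delta f) = 0.
Proof.
apply/funext => y; rewrite -(consg_eta y); move: (y ord0) (y \o _) => g {}y.
rewrite delta_consg; suff -> : delta (fun x => delta f (consg g x)) y = delta f y.
  by rewrite subrr.
elim: n g f y => [|n IHn] g f y.
  have -> : (fun x => delta f (consg g x)) = f - (fun=> f (fun=> g)).
    by apply/funext => x; rewrite delta_consg0.
  rewrite deltaB [LHS](_ : _ = delta f y - delta (fun=> f (fun=> g)) y) //.
  rewrite [X in _ - X](_ : _ = 0) ?subr0 //.
  by rewrite /delta !big_ord_recl big_ord0 addr0 expr0 expr1 mulr1z mulrN1z subrr.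
have -> : (fun x => delta f (consg g x)) = f - delta (fun x => f (consg g x)).
  by apply/funext => x; rewrite delta_consg.
rewrite deltaB [LHS](_ : _ = delta f y - delta (delta (fun x => f (consg g x))) y) //.
rewrite [X in _ - X](_ : _ = 0) ?subr0 //.
rewrite -(consg_eta y); move: (y ord0) (y \o _) => h {}y.
by rewrite delta_consg IHn subrr.
Qed.

End Cochains.

Section Free.
Variables (R : nzRingType) (G : groupType).
Notation X n := ('I_n.+1 -> Monoid.sort G).
Notation "g *x y" := ((fun i => g * y i)%g : X _) (at level 40).

Section Lift.
Variable n : nat.
Notation FX := {freeg (X n) / R}.
Implicit Types (V : lmodType R).

Lemma freegUZ a b (x : X n) : a *: (<< b *g x >> : FX) = << (a * b) *g x >>.
Proof. by apply/eqP/freeg_eqP => z; rewrite coeffZ !coeffU mulrA. Qed.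

Lemma fgliftE V (f : X n -> V) x : fglift f << x >> = f x.
Proof. by rewrite liftU scale1r. Qed.

Lemma fglift0 V (f : X n -> V) : fglift f 0 = 0.
Proof. by rewrite -(subrr 0) lift_is_additive subrr. Qed.

Lemma fgliftD V (f : X n -> V) : {morph fglift f : a b / a + b}.
Proof.
have fN c : fglift f (- c) = - fglift f c.
  by rewrite -[- c]sub0r lift_is_additive fglift0 sub0r.
by move=> a b; rewrite -[b]opprK lift_is_additive !fN.
Qed.

Lemma fgliftZ V (f : X n -> V) a D : fglift f (a *: D) = a *: fglift f D.
Proof.
elim/freeg_ind_dom0: D => [|b x D _ _ IH]; first by rewrite !scaler0 fglift0 scaler0.
by rewrite scalerDr !fgliftD IH freegUZ !liftU scalerDr scalerA.
Qed.

Lemma fglift_linear V (f : X n -> V) : linear (fglift f).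
Proof. by move=> a x y; rewrite fgliftD fgliftZ. Qed.

Lemma freeg_ext V (f h : FX -> V) : linear f -> linear h ->
  (forall x, f << x >> = h << x >>) -> f =1 h.
Proof.
move=> fL hL fh.
have z (k : FX -> V) : linear k -> k 0 = 0.
  by move=> kL; have := kL (-1) 0 0; rewrite scaler0 addr0 scaleN1r addNr.
have sc (k : FX -> V) a x : linear k -> k (a *: x) = a *: k x.
  by move=> kL; rewrite -[a *: x]addr0 kL z // addr0.
elim/freeg_ind_dom0 => [|b x D _ _ IH]; first by rewrite !z.
have -> : << b *g x >> = b *: << x >> :> FX by rewrite freegUZ mulr1.
by rewrite fL hL fh IH.
Qed.
End Lift.

Section FreeModule.
Variable n : nat.
Notation FX := {freeg (X n) / R}.
Let act g : FX -> FX := fglift (fun y => << g *x y >>).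
Fact fr_act1 x : act 1%g x = x.
Proof.
apply: (@freeg_ext n FX (act 1%g) id) => [||y] //; first exact: fglift_linear.
by rewrite /act fgliftE; congr << _ >>; apply/funext => i; rewrite mul1g.
Qed.
Fact fr_actM g h x : act (g * h)%g x = act g (act h x).
Proof.
apply: (@freeg_ext n FX (act (g * h)%g) (act g \o act h)) => [||y /=].
- exact: fglift_linear.
- by move=> a u v; rewrite /= /act !fglift_linear.
by rewrite /act !fgliftE; congr << _ >>; apply/funext => i; rewrite mulgA.
Qed.
Fact fr_actD g : {morph act g : x y / x + y}. Proof. exact: fgliftD. Qed.
Fact fr_actZ g a : {morph act g : x / a *: x}.
Proof. by move=> x; apply: fgliftZ. Qed.
Definition fr_mod : rgMod R G := RgMod fr_act1 fr_actM fr_actD fr_actZ.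

(** The universal equivariant cochain: by [fr_lift] and [fr_ext], homomorphisms out of [fr_mod] are
    the same as equivariant cochains. All passages between resolutions and cochains go through
    it. *)
Definition bas : cochain n G (rg_zg fr_mod) := fun y => << y >>.
Lemma bas_equivariant : equivariant bas.
Proof. by move=> g y; rewrite /= /act fgliftE. Qed.

Section ExtendHom.
Variables (M : rgMod R G) (f : cochain n G (rg_zg M)) (ef : equivariant f).
Fact fr_lift_subproof : is_hom (fglift f : fr_mod -> M).
Proof.
split=> [|g]; first exact: fglift_linear.
apply: freeg_ext => [||y].
- by move=> a x y; rewrite (rg_actD (r := fr_mod)) rg_actZ; apply: fglift_linear.
- by move=> a x y; rewrite fglift_linear rg_actD rg_actZ.
by rewrite /= /act !fgliftE; apply: ef.
Qed.
Definition fr_lift : rgHom fr_mod M := mk_hom fr_lift_subproof.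
Arguments fr_lift : simpl never.
Lemma fr_liftE y : fr_lift (bas y) = f y. Proof. exact: fgliftE. Qed.
End ExtendHom.
Arguments fr_lift M f ef : simpl never.

Lemma fr_ext (M : rgMod R G) (f h : rgHom fr_mod M) :
  (forall y, f (bas y) = h (bas y)) -> f =1 h.
Proof. by move=> fh; apply: freeg_ext => //; apply: linearP. Qed.

Lemma fr_projective : projective fr_mod.
Proof.
move=> M N f h fo; pose s y := projT1 (cid (fo (h (bas y)))).
have sE y : f (s y) = h (bas y) by rewrite /s; case: cid.
(* [G] acts freely on tuples, and each orbit has one member with first entry 1. Preimages are used
   only at these members and transported along the orbit, which makes the choice equivariant. *)
pose c : cochain n G (rg_zg M) := fun y => rg_act (y ord0) (s ((y ord0)^-1%g *x y)).
have ec : equivariant c.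
  move=> g y; rewrite /c /= -rg_actM; congr (rg_act _ (s _)).
  by apply/funext => i; rewrite invgM -mulgA mulKg.
exists (fr_lift ec) => x; move: x.
apply: (@fr_ext _ (cmph f (fr_lift ec)) h) => y.
rewrite homE fr_liftE /c rg_funG sE -rg_funG; congr (h _).
apply: (etrans (esym (bas_equivariant _ _))).
by congr bas; apply/funext => i; rewrite mulVKg.
Qed.

Lemma hom_equivariant (M : rgMod R G) (f : rgHom fr_mod M) :
  equivariant ((fun y => f (bas y)) : cochain n G (rg_zg M)).
Proof. by move=> g y; rewrite bas_equivariant; apply: rg_funG. Qed.

End FreeModule.
Arguments fr_lift n M f ef : simpl never.

Definition bdry n : rgHom (fr_mod n.+1) (fr_mod n) :=
  fr_lift (delta_equivariant (@bas_equivariant n)).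

Fact aug_equivariant :
  equivariant ((fun=> 1) : cochain 0 G (rg_zg (triv_mod R G))).
Proof. by []. Qed.
Definition std_aug : rgHom (fr_mod 0) (triv_mod R G) := fr_lift aug_equivariant.

Definition std : augmented (triv_mod R G) := Augmented bdry std_aug.

Arguments bdry : simpl never.
Arguments std_aug : simpl never.
Lemma bdryE n y : bdry n (bas y) = delta (@bas n) y.
Proof. exact: fr_liftE. Qed.

Lemma hom_bdry n (M : rgMod R G) (f : rgHom (fr_mod n) M) y :
  f (bdry n (bas y)) = delta ((fun z => f (bas z)) : cochain n G (rg_zg M)) y.
Proof.
rewrite bdryE; apply: (@delta_additive G (rg_zg (fr_mod n)) (rg_zg M) f).
exact: homD.
Qed.

(* [y_0 .. y_n] |-> [1 y_0 .. y_n]: a contraction that is linear, not equivariant. *)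
Let s n : fr_mod n -> fr_mod n.+1 := fglift (fun y => bas (consg 1%g y)).

Lemma std_contract n x : bdry n.+1 (s x) = x - s (bdry n x).
Proof.
move: x; apply: (@freeg_ext n.+1 (fr_mod n.+1)) => [a x y|a x y|y].
- by rewrite /s fglift_linear linearP.
- by rewrite /s linearP fglift_linear scalerBr opprD addrACA.
rewrite {1}/s fgliftE bdryE delta_consg -/(bas y) bdryE; congr (_ - _).
rewrite (@delta_additive G (rg_zg (fr_mod n)) (rg_zg (fr_mod n.+1)) (@s n)).
  have -> // : (fun x : X n => s (bas x)) = fun x => bas (consg 1%g x).
  by apply: funext => z; rewrite /s fgliftE.
exact: fgliftD.
Qed.

Lemma std_contract0 x : bdry 0 (s x) = x - std_aug x *: bas (fun=> 1%g).
Proof.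
move: x; apply: (@freeg_ext 0 (fr_mod 0)) => [a x y|a x y|y].
- by rewrite /s fglift_linear linearP.
- by rewrite linearP scalerDl scalerBr opprD addrACA scalerA.
rewrite {1}/s fgliftE bdryE delta_consg0 -/(bas y); congr (_ - _).
by rewrite fr_liftE scale1r.
Qed.

Lemma std_exact i : aug_exact std i.
Proof.
case: i => [|i] x; split=> [|[y <-]].
- move=> e; have {}e : std_aug x = 0 by [].
  by exists (s x); apply: (etrans (std_contract0 x)); rewrite e scale0r subr0.
- move: y; apply: (@fr_ext _ _ (cmph std_aug (bdry 0)) zeroh) => y.
  rewrite !homE.
  rewrite hom_bdry /delta !big_ord_recl big_ord0 !fr_liftE expr0 expr1.
  by rewrite addr0 mulrN1z subrr.
- move=> e; have {}e : bdry i x = 0 by [].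
  by exists (s x); apply: (etrans (std_contract x)); rewrite e /s fglift0 subr0.
move: y; apply: (@fr_ext _ _ (cmph (bdry i) (bdry i.+1)) zeroh) => y.
  rewrite !homE.
rewrite hom_bdry; have -> : (fun z => bdry i (bas z)) = delta (@bas i).
  by apply/funext => z; rewrite bdryE.
by rewrite delta_delta.
Qed.

Lemma std_proj i : projective (std i). Proof. exact: fr_projective. Qed.

Lemma std_onto : onto (aug_eps std).
Proof.
move=> a; exists (a *: bas (fun=> 1%g)).
by rewrite homZ fr_liftE /GRing.scale /= mulr1.
Qed.

End Free.
Arguments bas {R G n}.
Arguments fr_lift {R G n M f} ef : simpl never.
Arguments bdry {R G} n : simpl never.
Arguments std_aug {R G} : simpl never.

(** * Comparison of resolutions *)

Section Complexes.
Variables (R : nzRingType) (G : groupType).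
Implicit Types M N L : rgMod R G.

Definition tail M (C : augmented M) : augmented (C 0%N) :=
  @Augmented R G (C 0%N) (fun i => C i.+1) (fun i => aug_d C i.+1) (aug_d C 0).

Definition splice N L (C : augmented N) (v : rgHom N L) : augmented L :=
  @Augmented R G L (fun i => if i is j.+1 then C j else N)
    (fun i => match i return
         rgHom (C i) (if i is j.+1 then C j else N)
       with 0 => aug_eps C | j.+1 => aug_d C j end) v.

Definition push M N (C : augmented M) (v : rgHom M N) : augmented N :=
  @Augmented R G N C (aug_d C) (cmph v (aug_eps C)).

(* Used with z = 1 or -1, to absorb the signs in cap_bdry and in the cone. *)
Definition scale_d M (C : augmented M) (z : int) : augmented M :=
  @Augmented R G M C (fun i => mzh (aug_d C i) z) (aug_eps C).

Lemma tail_exact M (C : augmented M) i : aug_exact C i.+1 -> aug_exact (tail C) i.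
Proof. by case: i. Qed.

Lemma splice_exact N L (C : augmented N) (v : rgHom N L) :
  (forall x, v x = 0 <-> exists y, aug_eps C y = x) ->
  (forall i, aug_exact C i) -> forall i, aug_exact (splice C v) i.
Proof. by move=> ve eC [|[|i]] //=; apply: eC. Qed.

Lemma scale_d_exact M (C : augmented M) (z : int) i :
  z * z = 1 -> aug_exact C i -> aug_exact (scale_d C z) i.
Proof.
move=> z1 eC x; have zz N (y : N) : y *~ z *~ z = y by rewrite -mulrzA z1.
have kE : @aug_ker _ _ _ (scale_d C z) i x <-> @aug_ker _ _ _ C i x.
  case: i x {eC} => [|i] x //=; split=> [e|->]; last exact: mul0rz.
  by rewrite -[LHS]zz e mul0rz.
rewrite kE eC; split=> -[y yE]; exists (y *~ z); rewrite /= homMz ?zz //.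
Qed.

Lemma push_exact M N (C : augmented M) (v : rgHom M N) i :
  (forall x, v (aug_eps C x) = 0 -> aug_eps C x = 0) ->
  aug_exact C i -> aug_exact (push C v) i.
Proof.
case: i => [|i] // vi eC x; rewrite -[X in _ <-> X](eC x) /=.
by split=> [/vi|->] //; rewrite hom0.
Qed.

Lemma aug_dd M (C : augmented M) i x :
  aug_exact C i -> @aug_ker _ _ _ C i (aug_d C i x).
Proof. by move=> eC; apply/eC; exists x. Qed.

Section Comparison.
Variables (M N : rgMod R G) (C : augmented M) (D : augmented N).
(** A downward closed set of degrees in which exactness is available: those below [m] for an
    extension, all of them for a genuine resolution. *)
Variable L : nat -> Prop.
Hypothesis LS : forall i, L i.+1 -> L i.
Hypothesis exC : forall i, L i -> aug_exact C i.
Hypothesis exD : forall i, L i -> aug_exact D i.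

Definition chain_map (u : forall i, rgHom (C i) (D i)) :=
  forall i, L i -> forall x, aug_d D i (u i.+1 x) = u i (aug_d C i x).

Lemma chain_map_ker u i x : chain_map u -> (if i is j.+1 then L j else True) ->
  (forall x, aug_eps C x = 0 -> aug_eps D (u 0%N x) = 0) ->
  @aug_ker _ _ _ C i x -> @aug_ker _ _ _ D i (u i x).
Proof.
move=> cu Li u0; case: i Li x => [|i] Li x; first exact: u0.
by rewrite /= cu // => ->; rewrite hom0.
Qed.

(** Returns a lift if one exists and [zeroh] otherwise. The family can thus be defined by recursion
    in all degrees before lifts are shown to exist where [L] holds. *)
Let next i (w : rgHom (C i) (D i)) : rgHom (C i.+1) (D i.+1) :=
  if pselect (exists k : rgHom (C i.+1) (D i.+1),
                forall x, aug_d D i (k x) = w (aug_d C i x)) is left e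
  then projT1 (cid e) else zeroh.

Lemma lift_chain (v : rgHom (C 0%N) N) : projective (C 0%N) ->
  (forall i, L i -> projective (C i.+1)) ->
  (forall x, aug_eps C x = 0 -> v x = 0) ->
  (forall x, exists y, aug_eps D y = v x) ->
  exists2 u : forall i, rgHom (C i) (D i),
    forall x, aug_eps D (u 0%N x) = v x & chain_map u.
Proof.
move=> p0 pC vk vi.
have [u0 u0E] := proj_lift p0 vi.
pose u := nat_rect (fun i => rgHom (C i) (D i)) u0 next.
exists u => // i Li.
suff uk x : @aug_ker _ _ _ C i x -> @aug_ker _ _ _ D i (u i x).
  rewrite /= /next; case: pselect => [e|[]]; first by case: cid.
  apply: (@proj_lift _ _ _ _ _ (aug_d D i) (cmph (u i) (aug_d C i)) (pC i Li)) => x.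
  by apply/(exD Li)/uk/aug_dd/exC.
elim: i Li x => [|i IHi] Li x; first by rewrite /= u0E; apply: vk.
have {}IHi := IHi (LS Li).
rewrite /= => dx; rewrite /next; case: pselect => [e|[]].
  by case: cid => k /= ->; rewrite dx hom0.
have Li' := LS Li.
apply: (@proj_lift _ _ _ _ _ (aug_d D i) (cmph (u i) (aug_d C i)) (pC i Li')) => y.
by apply/(exD Li')/IHi/aug_dd/exC.
Qed.

Let pick i (w : rgHom (C i) (D i)) : rgHom (C i) (D i.+1) :=
  if pselect (exists k : rgHom (C i) (D i.+1), forall x, aug_d D i (k x) = w x)
  is left e then projT1 (cid e) else zeroh.

Section Homotopy.
Variable s : rgHom M (D 0%N).

(* The part of a null-homotopy that factors through the differential of C;
   in degree 0 it comes from s. *)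
Definition htpy_r (h : forall i, rgHom (C i) (D i.+1)) i : rgHom (C i) (D i) :=
  match i with
  | 0 => cmph s (aug_eps C)
  | j.+1 => cmph (h j) (aug_d C j)
  end.

Lemma htpy_rE h i x : @aug_ker _ _ _ C i x -> htpy_r h i x = 0.
Proof. by case: i x => [|i] x /= ->; rewrite hom0. Qed.

(** The map [s] is the homotopy in degree -1. The first conclusion reaches one degree past [L]: the
    remainder there is a cycle but need not be a boundary. [low_degrees] starts from this cycle in
    degree [m]. *)
Lemma null_homotopy (u : forall i, rgHom (C i) (D i)) : chain_map u ->
  (forall i, L i -> projective (C i)) ->
  (forall x, aug_eps D (u 0%N x - s (aug_eps C x)) = 0) ->
  exists h : forall i, rgHom (C i) (D i.+1),
    (forall i, (if i is j.+1 then L j else True) ->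
       forall x, @aug_ker _ _ _ D i (u i x - htpy_r h i x)) /\
    (forall i, L i -> forall x, u i x = htpy_r h i x + aug_d D i (h i x)).
Proof.
move=> cu pC u0.
pose h := nat_rect (fun i => rgHom (C i) (D i.+1))
  (pick (subh (u 0%N) (cmph s (aug_eps C))))
  (fun i hi => pick (subh (u i.+1) (cmph hi (aug_d C i)))).
have hE i : h i = pick (subh (u i) (htpy_r h i)) by case: i.
have step i : L i -> (forall x, @aug_ker _ _ _ D i (u i x - htpy_r h i x)) ->
    forall x, aug_d D i (h i x) = u i x - htpy_r h i x.
  move=> Li k x; rewrite hE /pick; case: pselect => [e|[]].
    by case: cid => l /= ->.
  apply: (@proj_lift _ _ _ _ _ (aug_d D i) (subh (u i) (htpy_r h i)) (pC i Li)) => y.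
  exact/(exD Li)/k.
exists h.
have K i : (if i is j.+1 then L j else True) ->
    forall x, @aug_ker _ _ _ D i (u i x - htpy_r h i x).
  elim: i => [|i IHi] Li x; first exact: u0.
  have {}IHi : forall x, @aug_ker _ _ _ D i (u i x - htpy_r h i x).
    by apply: IHi; case: i Li {x} => // i; apply: LS.
  rewrite /= homB cu // step // htpy_rE; last exact/aug_dd/exC.
  by rewrite subr0 subrr.
split=> // i Li x; rewrite step; first by rewrite addrC subrK.
- by [].
by apply: K; case: i Li {x} => // i; apply: LS.
Qed.
End Homotopy.
End Comparison.

(** * Mapping cones *)

Section Cone.
Variables (M N : rgMod R G) (C : augmented M) (D : augmented N).
Variable u : forall i, rgHom (C i) (D i).
Hypothesis cu : chain_map (fun=> True) u.
Hypotheses (exC : forall i, aug_exact C i) (exD : forall i, aug_exact D i).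

Definition cone_d (A B A' B' : rgMod R G) (d : rgHom A A') (w : rgHom B A') (e : rgHom B B') :
    rgHom (sum_mod A B) (sum_mod A' B') :=
  pairh (addh (cmph d (fsth A B)) (cmph w (sndh A B)))
        (mzh (cmph e (sndh A B)) (-1)).

(** The mapping cone of [u], where [C] is extended by its augmentation module [M] in degree -1 and
    the augmentation of [D] is dropped. Indices are lowered by one, so that the bottom term, the sum
    of [D 0] and [M], becomes the target of the augmentation. *)
Definition cone : augmented (sum_mod (D 0%N) M) :=
  @Augmented R G _ (fun i => sum_mod (D i.+1) (C i))
    (fun i => cone_d (aug_d D i.+1) (u i.+1) (aug_d C i))
    (cone_d (aug_d D 0) (u 0%N) (aug_eps C)).

Lemma cone_augE q f : aug_eps cone (q, f) = (aug_d D 0 q + u 0%N f, - aug_eps C f).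
Proof. by congr (_, _); apply: mulrN1z. Qed.

Lemma cone_dE j q f :
  aug_d cone j (q, f) = (aug_d D j.+1 q + u j.+1 f, - aug_d C j f).
Proof. by congr (_, _); apply: mulrN1z. Qed.

Lemma cone_exact i : aug_exact cone i.
Proof.
have ker (q : D i.+1) (f : C i) : @aug_ker _ _ _ cone i (q, f) <->
    aug_d D i q + u i f = 0 /\ @aug_ker _ _ _ C i f.
  case: i q f => [|i] q f; rewrite /= mulrN1z; split.
  - by case=> -> /eqP; rewrite oppr_eq0 => /eqP.
  - by case=> -> ->; rewrite oppr0.
  - by case=> -> /eqP; rewrite oppr_eq0 => /eqP.
  - by case=> -> ->; rewrite oppr0.
move=> [q f]; rewrite ker; split.
  case=> e /exC[f' f'E]; rewrite -f'E -cu // -homD in e.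
  have /exD[q' q'E] : @aug_ker _ _ _ D i.+1 (q + u i.+1 f') by [].
  exists (q', - f'); rewrite /= mulrN1z !homN opprK q'E f'E.
  by rewrite addrK.
case=> -[q' f'] /=; rewrite mulrN1z => -[<- <-].
split; last by rewrite -homN; apply: aug_dd.
have /= dd : @aug_ker _ _ _ D i.+1 (aug_d D i.+1 q') by apply: aug_dd.
by rewrite homD dd add0r cu // homN subrr.
Qed.

End Cone.

End Complexes.

(** * Finite projective dimension *)

Section Truncation.
Variables (R : nzRingType) (G : groupType).
Implicit Types M N : rgMod R G.

Definition zero_aug N : augmented N :=
  @Augmented R G N (fun=> zero_mod R G) (fun=> zeroh) zeroh.

Lemma zero_aug_exact N i : aug_exact (zero_aug N) i.
Proof.
move=> x; split=> [_|_]; first by exists 0; rewrite hom0 [x]zero_modE.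
by rewrite [x]zero_modE; case: i {x}.
Qed.

(* When C is a projective resolution of N and 0 < i, this says Ext^i(N, -) = 0. *)
Definition ext_vanish N (C : augmented N) (i : nat) :=
  forall M (f : rgHom (C i) M), (forall x, @aug_ker _ _ _ C i x -> f x = 0) ->
  match i return rgHom (C i) M -> Prop with
  | 0 => fun f => exists g : rgHom N M, forall x, f x = g (aug_eps C x)
  | j.+1 => fun f => exists g : rgHom (C j) M, forall x, f x = g (aug_d C j x)
  end f.

(** Here [N] is a projective term of a longer resolution and [C] resolves only the image of
    [aug_eps C]. Hence the new complex must have the same image in [N], and the induction peels off
    one projective term at a time. *)
Lemma truncate J N (C : augmented N) : projective N ->
  (forall i, projective (C i)) -> (forall i, aug_exact C i) -> ext_vanish C J ->
  exists C' : augmented N,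
    [/\ forall i, projective (C' i), forall i, aug_exact C' i,
        forall x, (exists y, aug_eps C y = x) <-> (exists y, aug_eps C' y = x)
      & forall i, (J < i)%N -> forall x : C' i, x = 0].
Proof.
elim: J N C => [|J IHJ] N C pN pC eC vJ.
  (* Vanishing in degree 0 extends the projection onto the coimage of [aug_eps C] to all of [N]. The
     image is thus a retract of [N], so it is projective and can end the complex. *)
  have [|r rE] := vJ _ (coim_pi (aug_eps C)).
    by move=> x /= e; rewrite -(hom0 (coim_pi _)); apply/coim_piP; rewrite e hom0.
  have rK q : r (coim_inj (aug_eps C) q) = q.
    by have [x <-] := coim_onto q; rewrite coim_injE rE.
  exists (splice (zero_aug _) (coim_inj (aug_eps C))); split.
  - by case=> [|i] /=; [apply: projective_retract rK pN | apply: projective_zero].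
  - apply: splice_exact => [x|i]; last exact: zero_aug_exact.
    split=> [e|[y <-]]; last by rewrite !hom0.
    by exists 0; rewrite hom0 -[x]rK e hom0.
  - move=> x; split=> [[y <-]|[q <-]]; first by exists (coim_pi _ y); apply: coim_injE.
    by have [y <-] := coim_onto q; exists y; apply/esym/coim_injE.
  by case=> // i _ x; apply: zero_modE.
have [| | |M f fk|C' [pC' eC' iC' zC']] := IHJ _ (tail C).
- exact: pC.
- by move=> i; apply: pC.
- by move=> i; apply: tail_exact.
- have := vJ M f; case: J f fk {IHJ vJ} => [|J] f fk; exact.
exists (splice C' (aug_eps C)); split.
- by case=> [|i] /=; [apply: pC | apply: pC'].
- by apply: splice_exact => // x; rewrite -iC'; apply: (eC 0%N x).
- by [].
by case=> // i; apply: zC'.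
Qed.

Lemma projdim_of_vanish N (C : augmented N) J : (forall i, projective (C i)) ->
  onto (aug_eps C) -> (forall i, aug_exact C i) -> ext_vanish C J.+1 ->
  projdim_le N J.+1.
Proof.
move=> pC oC eC vC; have [| | |M f fk|C' [pC' eC' iC' zC']] := @truncate J _ (tail C).
- exact: pC.
- by move=> i; apply: pC.
- by move=> i; apply: tail_exact.
- have := vC M f; case: J f fk {vC} => [|J] f fk; exact.
exists (splice C' (aug_eps C)); split=> //.
- by case=> [|i] /=; [apply: pC | apply: pC'].
- by apply: splice_exact => // x; rewrite -iC'; apply: (eC 0%N x).
by case=> // i; apply: zC'.
Qed.

End Truncation.

(** * Cup product as a chain map *)

Section Pairing.
Variables (G : groupType) (A B D : zgMod G) (b : A -> B -> D).
Hypothesis bDl : forall y, {morph b^~ y : u v / u + v}.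
Hypothesis bDr : forall x, {morph b x : u v / u + v}.

(** The Alexander-Whitney formula for an arbitrary biadditive pairing. It is applied to scalars
    acting on a module, to p-adic integers acting on a torsion module, and to the product of two
    twisted copies of the p-adic integers. *)
Definition pair_cochain n i (a : cochain n G A) (f : cochain i G B) :
    cochain (i + n)%N G D :=
  fun x => b (a (fun k => x (inord k))) (f (fun k => x (inord (n + k)%N))).

Lemma morph_nmod (U V : zmodType) (f : U -> V) :
  {morph f : u v / u + v} -> nmod_morphism f.
Proof. by move=> fD; split=> //; apply: (addrI (f 0)); rewrite -fD !addr0. Qed.

Let bl y : {additive A -> D} :=
  HB.pack (b^~ y) (GRing.isNmodMorphism.Build A D (b^~ y) (morph_nmod (bDl y))).
Let br x : {additive B -> D} :=
  HB.pack (b x) (GRing.isNmodMorphism.Build B D (b x) (morph_nmod (bDr x))).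

Lemma pair0l y : b 0 y = 0. Proof. exact: (raddf0 (bl y)). Qed.
Let bMzl x y z : b (x *~ z) y = b x y *~ z. Proof. exact: (raddfMz (bl y)). Qed.
Let bMzr x y z : b x (y *~ z) = b x y *~ z. Proof. exact: (raddfMz (br x)). Qed.
Let bsuml I r (P : pred I) F y :
  b (\sum_(j <- r | P j) F j) y = \sum_(j <- r | P j) b (F j) y.
Proof. exact: (raddf_sum (bl y)). Qed.
Let bsumr I r (P : pred I) F x :
  b x (\sum_(j <- r | P j) F j) = \sum_(j <- r | P j) b x (F j).
Proof. exact: (raddf_sum (br x)). Qed.

Notation res n y := (@res G n y).

Lemma pair_res n i a f y :
  @pair_cochain n i a f (res (i + n)%N y) =
  b (a (res n y)) (f (res i (fun k => y (n + k)%N))).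
Proof.
rewrite /pair_cochain /Defs.res; congr (b (a _) (f _)); apply/funext => k.
  by rewrite inordK // ltnS (leq_trans (leq_ord k)) // leq_addl.
by rewrite inordK // ltnS addnC leq_add2r leq_ord.
Qed.

Lemma delta_pair n i (a : cochain n G A) (f : cochain i G B) x :
  delta a = 0 ->
  delta (pair_cochain a f) x = pair_cochain a (delta f : cochain i.+1 G B) x *~ (-1) ^+ n.
Proof.
move=> da; rewrite (resE x); set y := fun k => _.
rewrite (pair_res a (delta f)) [LHS]delta_res.
under eq_bigr => j _ do rewrite pair_res.
have le_n : (n.+1 <= (i + n).+2)%N by rewrite ltnS -addSn leq_addl.
rewrite (big_cat_nat _ le_n) //= [X in b _ X]delta_res (big_nat_recl i.+1) //=.
(* Evaluated on the first n + 2 vertices, [da] rewrites the sum over the faces omitting one of y_0,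
   ..., y_n as the single term omitting y_{n+1}. Paired with [F], this is the zeroth term of
   [delta f]. *)
have := congr1 (fun u => b (u (res n.+1 y)) (f (res i (fun k => y (n.+1 + k)%N)))) da.
rewrite delta_res (big_nat_recr n.+1) //= [in RHS]/GRing.zero /= pair0l.
set U := a (res n y); set F := f (res i (fun k => y (n.+1 + k)%N)).
have -> : a (res n (fun k => y (bump n.+1 k))) = U.
  congr a; apply/funext => k; rewrite /Defs.res /bump.
  by rewrite ltnNge -ltnS ltn_ord.
have -> : f (res i (fun k => y (n + bump 0 k)%N)) = F.
  by congr f; apply/funext => k; rewrite /Defs.res /bump /= addnCA.
rewrite bDl bDr bMzl expr0 mulr1z mulrzDl exprS mulN1r mulrNz => /eqP.
rewrite subr_eq0 bsuml => /eqP {da}<-; congr (_ + _).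
  apply: eq_big_nat => j /andP[_ lt_j]; rewrite bMzl.
  congr (b _ (f _) *~ _); apply/funext => k; rewrite /Defs.res /bump.
  by rewrite (leq_trans _ (leq_addr k n)).
rewrite bsumr mulrz_suml.
have -> : (i + n).+2 = (i.+1 + n.+1)%N by rewrite addSn addnS.
rewrite -{1}[n.+1]add0n big_addn addnK.
apply: eq_big_nat => j _; rewrite bMzr -mulrzA -exprD.
rewrite addSnnS; congr (b (a _) (f _) *~ _).
  apply/funext => k; rewrite /Defs.res /bump.
  by rewrite leqNgt ltn_addl.
apply/funext => k; rewrite /Defs.res /bump; congr y.
by rewrite -addSnnS (addnC j.+1) leq_add2l addnCA.
Qed.

End Pairing.

Section CapMap.
Variables (R : nzRingType) (G : groupType) (n : nat).
Variable c : cochain n G (rg_zg (triv_mod R G)).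
Hypotheses (ec : equivariant c) (dc : delta c = 0).

Definition scale_pair (M : rgMod R G) (a : rg_zg (triv_mod R G)) (v : rg_zg M) : rg_zg M :=
  (a : R) *: (v : M).

Lemma scale_pairDl (M : rgMod R G) (v : rg_zg M) :
  {morph (@scale_pair M)^~ v : a b / a + b}.
Proof. by move=> a b; apply: scalerDl. Qed.
Lemma scale_pairDr (M : rgMod R G) a : {morph @scale_pair M a : v w / v + w}.
Proof. by move=> v w; apply: scalerDr. Qed.

Definition scale_cup (M : rgMod R G) j (f : cochain j G (rg_zg M)) :
  cochain (j + n) G (rg_zg M) := pair_cochain (@scale_pair M) c f.

Lemma scale_cup_equivariant (M : rgMod R G) j (f : cochain j G (rg_zg M)) :
  equivariant f -> equivariant (scale_cup f).
Proof.
move=> ef g x; rewrite /scale_cup /pair_cochain.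
by rewrite (ec g (fun k => x (inord k))) ef; apply/esym/rg_actZ.
Qed.

(* [y_0 .. y_{j+n}] |-> c(y_0 .. y_n) [y_n .. y_{n+j}]: precomposition with
   this map is the cup product with c. *)
Definition cap j : rgHom (fr_mod R G (j + n)) (fr_mod R G j) :=
  fr_lift (scale_cup_equivariant (@bas_equivariant R G j)).

Lemma hom_cap (M : rgMod R G) j (f : rgHom (fr_mod R G j) M) y :
  f (cap j (bas y)) = scale_cup (fun z => f (bas z)) y.
Proof. by rewrite fr_liftE; apply: homZ. Qed.

Lemma cap_bdry j z :
  bdry j (cap j.+1 z) = cap j (bdry (j + n) z) *~ (-1) ^+ n.
Proof.
move: z; apply: (@fr_ext _ _ _ _ (cmph (bdry j) (cap j.+1))
  (mzh (cmph (cap j) (bdry (j + n))) ((-1) ^+ n))) => y.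
rewrite !homE hom_bdry hom_cap.
have -> : (fun z => cap j (bas z)) = scale_cup bas.
  by apply/funext => z; rewrite fr_liftE.
have dE := delta_pair (@scale_pairDl (fr_mod R G j)) (@scale_pairDr (fr_mod R G j))
  bas y dc.
rewrite (dE : delta (scale_cup bas) y = _) -mulrzA -expr2 sqrr_sign mulr1z.
have -> // : (fun z => bdry j (bas z)) = delta (@bas R G j).
by apply/funext => z; apply: bdryE.
Qed.

Lemma cap_aug (z : fr_mod R G n) : std_aug (cap 0 z) = fr_lift ec z.
Proof.
move: z; apply: (@fr_ext _ _ _ _ (cmph std_aug (cap 0)) (fr_lift ec)) => y.
rewrite homE hom_cap fr_liftE /scale_cup /pair_cochain /scale_pair.
rewrite fr_liftE [LHS]mulr1; congr c; apply/funext => k; congr y.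
exact: inord_val.
Qed.

End CapMap.

Section ShiftedStandard.
Variables (R : nzRingType) (G : groupType) (s : nat).

(** For s = m.+1, term [j] is the source of [cap] in degree [j] for a cocycle of degree m.+2. With
    [j] as the first summand the successor of an index computes, so no transport between degrees is
    needed. *)
Definition std_shift : augmented (fr_mod R G s) :=
  @Augmented R G (fr_mod R G s) (fun j => fr_mod R G (j + s.+1))
    (fun j => bdry (j + s.+1)) (bdry s).

Lemma std_shift_exact i : aug_exact std_shift i.
Proof.
case: i => [|i]; first exact: (@std_exact R G s.+1).
exact: (@std_exact R G (i.+1 + s.+1)).
Qed.

Lemma std_shift_proj i : projective (std_shift i).
Proof. exact: fr_projective. Qed.
End ShiftedStandard.

(** * The resolution obtained from an extension *)

Section Periodicity.
Variables (R : nzRingType) (G : groupType).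
Notation F := (fr_mod R G).

(** Together with [cap_inj]: bijectivity of the cup product with [c] on cohomology in degree [j.+1],
    on the level of homomorphisms out of the standard resolution. *)
Definition cap_surj n c ec (N : rgMod R G) j :=
  forall f : rgHom (F (j.+1 + n)) N, (forall z, f (bdry (j.+1 + n) z) = 0) ->
  exists (h : rgHom (F j.+1) N) (g : rgHom (F (j + n)) N),
    (forall z, h (bdry j.+1 z) = 0) /\
    forall z, f z = h (@cap R G n c ec j.+1 z) + g (bdry (j + n) z).

Definition cap_inj n c ec (N : rgMod R G) j :=
  forall (h : rgHom (F j.+1) N) (g : rgHom (F (j + n)) N),
    (forall z, h (bdry j.+1 z) = 0) ->
    (forall z, h (@cap R G n c ec j.+1 z) = g (bdry (j + n) z)) ->
  exists k : rgHom (F j) N, forall z, h z = k (bdry j z).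

Variables (m : nat) (P : augmented (triv_mod R G)) (A : rgMod R G).
Variables (dA : rgHom A (P m)) (iA : rgHom (triv_mod R G) A).
Hypothesis exP : forall i, (i < m)%N -> aug_exact P i.
Hypothesis exPm : forall x : P m, @aug_ker _ _ _ P m x <-> exists a, dA a = x.
Hypothesis exA : forall a, dA a = 0 <-> exists c, iA c = a.
Hypothesis injA : injective iA.
Hypothesis pP : forall i, (i <= m)%N -> projective (P i).

Variable Q : augmented A.
Hypothesis pQ : forall i, projective (Q i).
Hypothesis oQ : onto (aug_eps Q).
Hypothesis exQ : forall i, aug_exact Q i.

Variables (phi : forall i, rgHom (F i) (P i)) (phiA : rgHom (F m.+1) A).
Variables (ch : rgHom (F m.+2) (triv_mod R G)).
Hypothesis phi0 : forall z, aug_eps P (phi 0%N z) = std_aug z.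
Hypothesis phiS : forall i, (i < m)%N -> forall z,
  aug_d P i (phi i.+1 z) = phi i (bdry i z).
Hypothesis phiAE : forall z, dA (phiA z) = phi m (bdry m z).
Hypothesis chE : forall z, iA (ch z) = phiA (bdry m.+1 z).

Variable c : cochain m.+2 G (rg_zg (triv_mod R G)).
Hypotheses (ec : equivariant c) (dc : delta c = 0).
Variable b : rgHom (F m.+1) (triv_mod R G).
Hypothesis cE : forall z, ch z = fr_lift ec z + b (bdry m.+1 z).

Let L i := (i < m)%N.
Let LS i : L i.+1 -> L i. Proof. exact: ltnW. Qed.
Let Lm : if m is j.+1 then L j else True.
Proof. by rewrite /L; case: m. Qed.
Let std_ex i : aug_exact (std R G) i. Proof. exact: std_exact. Qed.
Let dd i (z : F i.+1) : @aug_ker _ _ _ (std R G) i (bdry i z).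
Proof. exact: aug_dd. Qed.
Let bb i (z : F i.+2) : bdry i (bdry i.+1 z) = 0. Proof. exact: (@dd i.+1 z). Qed.

Let eT := cmph dA (aug_eps Q).

Lemma eT_ker q : @aug_ker _ _ _ P m (eT q).
Proof. by apply/exPm; exists (aug_eps Q q). Qed.

(* The standard resolution and the extension are homotopy equivalent in degrees
   <= m; degree m + 1 gives the data needed to continue to the right. *)
Lemma low_degrees : exists (u : rgHom (F m.+1) (Q 0%N)) (v : rgHom (Q 0%N) (F m.+1)),
  [/\ forall z, aug_eps Q (u z) = phiA z,
      forall q, eT q = 0 -> bdry m (v q) = 0,
      exists s : rgHom (P m) (Q 0%N),
        forall q, eT (u (v q) - q - s (eT q)) = 0
    & exists s : rgHom (F m) (F m.+1),
        forall z, bdry m (v (u z) - z - s (bdry m z)) = 0].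
Proof.
have [u uE] : exists u : rgHom (F m.+1) (Q 0%N), forall z, aug_eps Q (u z) = phiA z.
  by apply: proj_lift => [|z]; [apply: fr_projective | apply: oQ].
have [|i Li|x|x|psi psi0 psiS] := @lift_chain _ _ _ _ P (std R G) L LS exP
  (fun i _ => @std_ex i) (aug_eps P).
- exact: pP.
- exact: pP.
- by [].
- exact: std_onto.
have [v vE] : exists v : rgHom (Q 0%N) (F m.+1), forall q, bdry m (v q) = psi m (eT q).
  apply: (@proj_lift _ _ _ _ _ (bdry m) (cmph (psi m) eT)) => // q.
  apply/(@std_ex m).
  apply: (chain_map_ker psiS Lm) (eT_ker q).
  by move=> x; rewrite psi0.
have [|i /ltnW|x|hP [/(_ m Lm) hPm _]] := @null_homotopy _ _ _ _ P P L LS exP exP zeroh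
  (fun i => subh (cmph (phi i) (psi i)) (idh (P i))).
- by move=> i Li x; rewrite !homE homB phiS // psiS.
- exact: pP.
- by rewrite !homE subr0 homB phi0 -[aug_eps P x]psi0 subrr.
have [|i _|x|hF [/(_ m Lm) hFm _]] := @null_homotopy _ _ _ _ (std R G) (std R G) L LS
  (fun i _ => @std_ex i) (fun i _ => @std_ex i) zeroh
  (fun i => subh (cmph (psi i) (phi i)) (idh (F i))).
- by move=> i Li x; rewrite !homE homB psiS // -phiS.
- exact: fr_projective.
- rewrite !homE subr0 homB; apply/eqP; rewrite subr_eq0; apply/eqP.
  by rewrite (psi0 (phi 0%N x)) phi0.
move: hPm hFm; set rP := htpy_r _ _ _; set rF := htpy_r _ _ _ => hPm hFm.
(* In degree [m] a cycle of [P] comes from [A], hence from [Q 0], so the remainder of the homotopy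
   lifts along [eT]. This replaces exactness of [P] at [m]. *)
have [sP sPE] : exists s : rgHom (P m) (Q 0%N), forall x,
    eT (s x) = phi m (psi m x) - x - rP x.
  apply: (@proj_lift _ _ _ _ _ eT (subh (subh (cmph (phi m) (psi m)) (idh _)) rP)).
    exact: pP.
  move=> x; have /exPm[a aE] := hPm x; have [q qE] := oQ a.
  by exists q; rewrite /eT homE qE aE.
have [sF sFE] : exists s : rgHom (F m) (F m.+1), forall x,
    bdry m (s x) = psi m (phi m x) - x - rF x.
  apply: (@proj_lift _ _ _ _ _ (bdry m) (subh (subh (cmph (psi m) (phi m)) (idh _)) rF)).
    exact: fr_projective.
  by move=> x; have /(@std_ex m) := hFm x.
exists u, v; split=> //.
- by move=> q e; rewrite vE e hom0.
- exists sP => q; rewrite !homB sPE.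
  have -> : eT (u (v q)) = phi m (psi m (eT q)) by rewrite /eT homE uE phiAE vE.
  by rewrite [rP _]htpy_rE ?subr0 ?subrr //; apply: eT_ker.
- exists sF => z; rewrite !homB sFE vE.
  have -> : eT (u z) = phi m (bdry m z) by rewrite /eT homE uE phiAE.
  by rewrite [rF _]htpy_rE ?subr0 ?subrr //; apply: dd.
Qed.

Let sg := ((-1) ^+ m.+2 : int).
Let sgsg : sg * sg = 1. Proof. by rewrite /sg -expr2 sqrr_sign. Qed.
Let mzK (M : rgMod R G) (x : M) : x *~ sg *~ sg = x.
Proof. by rewrite -mulrzA sgsg. Qed.

(** Continues P_0, ..., P_m to the left beyond [Q 0], by the sums of Q_{i+1} and F_i. With the sign
    [- sg] the cone differential on the summand F is [sg] times [bdry], which is the sign needed to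
    compare it with [cap]. *)
Let T (lam : forall i, rgHom (F i) (Q i)) : augmented (Q 0%N) :=
  push (cone (C := scale_d (std R G) (- sg)) lam) (fsth (Q 0%N) (triv_mod R G)).

Lemma exact_T : exists lam : forall i, rgHom (F i) (Q i),
  [/\ forall i, aug_exact (T lam) i,
      forall q, eT q = 0 <-> exists t, aug_eps (T lam) t = q
    & forall t, aug_eps Q (aug_eps (T lam) t) = iA (std_aug t.2)].
Proof.
have ex' i : aug_exact (scale_d (std R G) (- sg)) i.
  by apply: scale_d_exact => //; rewrite mulrNN.
have [||x|x|lam lam0 lamS] := @lift_chain _ _ _ _ (scale_d (std R G) (- sg)) Q
  (fun=> True) (fun _ _ => I) (fun i _ => ex' i) (fun i _ => @exQ i) (cmph iA std_aug).
- exact: fr_projective.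
- by move=> i _; apply: fr_projective.
- by rewrite homE /= => ->; rewrite hom0.
- exact: oQ.
exists lam; have epsE q z : aug_eps Q (aug_d Q 0 q + lam 0%N z) = iA (std_aug z).
  by rewrite homD lam0 homE (@aug_dd _ _ _ Q 0%N q) ?add0r.
split=> [i|q|[q z]]; last exact: epsE.
  apply: push_exact; last exact: cone_exact.
  (* Forgetting the second component of the cone augmentation loses nothing: if the component in
     [Q 0] vanishes, injectivity of [iA] makes the other vanish too. *)
  move=> [q z]; rewrite cone_augE => e; have {}e : aug_d Q 0 q + lam 0%N z = 0 by [].
  have := epsE q z; rewrite e hom0 => /esym.
  by rewrite -[X in _ = X](hom0 iA) => /injA az; rewrite [aug_eps _ _]az oppr0.
split=> [/exA[a aE]|[[q' z] <-]].
  have [z zE] := std_onto a.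
  have /exQ[q' q'E] : @aug_ker _ _ _ Q 0%N (q - lam 0%N z).
    by rewrite /= homB lam0 homE -aE zE subrr.
  by exists (q', z); rewrite /= q'E subrK.
by apply/exA; exists (std_aug z); apply: (esym (epsE q' z)).
Qed.

(** Both complexes continue resolutions that [low_degrees] already compares, so its maps and
    homotopies propagate upwards. The clause on [ch] says that the second component of [Phi] lifts
    the Yoneda cocycle; [cap_comparison] starts from it. *)
Lemma tail_equivalence : exists lam : forall i, rgHom (F i) (Q i),
  exists (Phi : forall j, rgHom (std_shift R G m.+1 j) (T lam j))
         (Psi : forall j, rgHom (T lam j) (std_shift R G m.+1 j)),
  [/\ chain_map (C := std_shift R G m.+1) (D := T lam) (fun=> True) Phi,
      chain_map (C := T lam) (D := std_shift R G m.+1) (fun=> True) Psi,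
      forall z, ch z = std_aug (Phi 0%N z).2,
      (forall j, exists (k : rgHom (F (j + m.+2)) (F (j.+1 + m.+2))) l, forall z,
         Psi j.+1 (Phi j.+1 z) =
         z + k (bdry (j + m.+2) z) + bdry (j.+1 + m.+2) (l z))
    & forall j, exists (k : rgHom (T lam j) (T lam j.+1)) l, forall t,
         Phi j.+1 (Psi j.+1 t) =
         t + k (aug_d (T lam) j t) + aug_d (T lam) j.+1 (l t)].
Proof.
have [u [v [uE vE [sP sPE] [sF sFE]]]] := low_degrees.
have [lam [exT T0 epsT]] := exact_T.
pose X := std_shift R G m.+1.
have exX i : aug_exact X i by apply: std_shift_exact.
have pX i : projective (X i) by apply: std_shift_proj.
have pT i : projective (T lam i).
  by apply: projective_sum; [apply: pQ | apply: fr_projective].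
have [||x|x|Phi Phi0 PhiS] := @lift_chain _ _ _ _ X (T lam)
  (fun=> True) (fun _ _ => I) (fun i _ => exX i) (fun i _ => exT i) (cmph u (aug_eps X)).
- exact: pX.
- by [].
- by rewrite homE => ->; rewrite hom0.
- by apply/T0; rewrite /eT !homE uE phiAE bb hom0.
have [||x|x|Psi Psi0 PsiS] := @lift_chain _ _ _ _ (T lam) X
  (fun=> True) (fun _ _ => I) (fun i _ => exT i) (fun i _ => exX i) (cmph v (aug_eps (T lam))).
- exact: pT.
- by [].
- by rewrite homE => ->; rewrite hom0.
- by apply/(@std_ex m.+1)/vE/T0; exists x.
have [sT sTE] : exists s : rgHom (Q 0%N) (T lam 0%N), forall q,
    aug_eps (T lam) (s q) = u (v q) - q - sP (eT q).
  apply: (@proj_lift _ _ _ _ _ (aug_eps (T lam))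
    (subh (subh (cmph u v) (idh _)) (cmph sP eT))) => // q.
  exact/T0/sPE.
have [sX sXE] : exists s : rgHom (F m.+1) (F m.+2), forall z,
    bdry m.+1 (s z) = v (u z) - z - sF (bdry m z).
  apply: (@proj_lift _ _ _ _ _ (bdry m.+1)
    (subh (subh (cmph v u) (idh _)) (cmph sF (bdry m)))); first exact: fr_projective.
  move=> z; exact/(@std_ex m.+1)/sFE.
have {}Phi0 x : aug_eps (T lam) (Phi 0%N x) = u (aug_eps X x) by apply: Phi0.
have {}Psi0 x : aug_eps X (Psi 0%N x) = v (aug_eps (T lam) x) by apply: Psi0.
exists lam, Phi, Psi; split=> //.
- by move=> z; apply: injA; rewrite chE -uE -epsT Phi0.
- move=> j; have [|||h [_ hE]] := @null_homotopy _ _ _ _ X X (fun=> True)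
    (fun _ _ => I) (fun i _ => exX i) (fun i _ => exX i) sX
    (fun i => subh (cmph (Psi i) (Phi i)) (idh (X i))).
  + by move=> i _ x; rewrite !homE homB PsiS // PhiS.
  + by [].
  + move=> z; rewrite !homE !homB [aug_eps X (sX _)]sXE Psi0 Phi0.
    have -> : bdry m (aug_eps X z) = 0 by apply: bb.
    by rewrite hom0 subr0 subrr.
  exists (h j), (h j.+1) => z; have := hE j.+1 I z; rewrite !homE => /eqP.
  by rewrite subr_eq addrC addrA => /eqP.
- move=> j; have [|||h [_ hE]] := @null_homotopy _ _ _ _ (T lam) (T lam) (fun=> True)
    (fun _ _ => I) (fun i _ => exT i) (fun i _ => exT i) sT
    (fun i => subh (cmph (Phi i) (Psi i)) (idh (T lam i))).
  + move=> i _ x; change (aug_d (T lam) i (Phi i.+1 (Psi i.+1 x) - x) =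
      Phi i (Psi i (aug_d (T lam) i x)) - aug_d (T lam) i x).
    by rewrite homB PhiS // PsiS.
  + by [].
  + move=> t; change (aug_eps (T lam) (Phi 0%N (Psi 0%N t) - t -
      sT (aug_eps (T lam) t)) = 0).
    rewrite !homB sTE Phi0 Psi0.
    have -> : eT (aug_eps (T lam) t) = 0 by apply/T0; exists t.
    by rewrite hom0 subr0 subrr.
  exists (h j), (h j.+1) => t.
  have /eqP : Phi j.+1 (Psi j.+1 t) - t =
    h j (aug_d (T lam) j t) + aug_d (T lam) j.+1 (h j.+1 t) by apply: (hE j.+1 I t).
  by rewrite subr_eq addrC addrA => /eqP.
Qed.

Let inr (M N : rgMod R G) : rgHom N (sum_mod M N) := pairh zeroh (idh N).

(** Inclusion of the summand F respects differentials, up to sign, only where [Q] has died: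
    elsewhere [lam] contributes a component in [Q]. *)
Let chain_T lam j (z : F j.+1) : (forall q : Q j.+1, q = 0) ->
  aug_d (T lam) j (inr _ _ z) = inr _ _ (bdry j z *~ sg).
Proof.
move=> q0; rewrite [LHS]cone_dE homE; congr (_, _).
  by rewrite hom0 add0r; apply: q0.
by rewrite /= mulrNz opprK.
Qed.

(** Both maps lift the same class: [ch] and [c] differ by the coboundary of [b], and a lift of [b]
    to [F 0] starts the homotopy. *)
Lemma cap_comparison (lam : forall i, rgHom (F i) (Q i))
    (Phi : forall j, rgHom (std_shift R G m.+1 j) (T lam j)) :
  chain_map (C := std_shift R G m.+1) (D := T lam) (fun=> True) Phi ->
  (forall z, ch z = std_aug (Phi 0%N z).2) ->
  forall j, exists (k : rgHom (F (j + m.+2)) (F j.+1)) l, forall z,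
    (Phi j.+1 z).2 = cap ec j.+1 z + k (bdry (j + m.+2) z) + bdry j.+1 (l z).
Proof.
move=> PhiS Phi0 j.
have [s sE] : exists s : rgHom (F m.+1) (F 0%N), forall z, std_aug (s z) = b z.
  apply: (@proj_lift _ _ _ _ _ std_aug b); first exact: fr_projective.
  by move=> z; apply: std_onto.
have exF i : aug_exact (scale_d (std R G) sg) i by apply: scale_d_exact.
have [|i _|z|h [_ hE]] := @null_homotopy _ _ _ _ (std_shift R G m.+1)
  (scale_d (std R G) sg) (fun=> True) (fun _ _ => I)
  (fun i _ => @std_shift_exact R G m.+1 i) (fun i _ => exF i) s
  (fun i => subh (cmph (sndh _ _) (Phi i)) (cap ec i)).
- move=> i _ z; change (bdry i ((Phi i.+1 z).2 - cap ec i.+1 z) *~ sg =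
    (Phi i (bdry (i + m.+2) z)).2 - cap ec i (bdry (i + m.+2) z)).
  rewrite homB mulrzBl cap_bdry // mzK; congr (_ - _).
  have <- := congr1 snd (PhiS i I z); case: (Phi i.+1 z) => q f.
  by rewrite [aug_d _ _ _]cone_dE /= mulrNz opprK.
- exact: fr_projective.
- change (std_aug ((Phi 0%N z).2 - cap ec 0 z - s (bdry m.+1 z)) = 0).
  by rewrite !homB -Phi0 cap_aug sE cE -addrA -opprD subrr.
exists (h j), (mzh (h j.+1) sg) => z; have := hE j.+1 I z; rewrite !homE => /eqP.
by rewrite subr_eq addrC addrA homMz => /eqP.
Qed.

Variable d : nat.
Hypothesis Qd : forall i, (d < i)%N -> forall x : Q i, x = 0.

(** Beyond [d] only the summand F of [T] survives, so pulling [f] back along [Psi] gives a cocycle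
    [h] on F. Pulling [h] back along [Phi] returns [f] up to a coboundary, and the second component
    of [Phi] is [cap] up to homotopy. *)
Lemma cap_surj_of_extension N j : (d <= j.+1)%N -> cap_surj ec N j.
Proof.
move=> dj f fz; have [lam [Phi [Psi [PhiS PsiS chE' PP _]]]] := tail_equivalence.
have [k [l kl]] := PP j.
have [k' [l' kl']] := cap_comparison PhiS chE' j.
pose h := cmph f (cmph (Psi j.+1) (inr (Q j.+2) (F j.+1))).
have hz z : h (bdry j.+1 z) = 0.
  have := fz (Psi j.+2 (inr _ _ z)); rewrite [bdry _ _]PsiS // chain_T; last exact: Qd.
  by rewrite !homMz => /(congr1 (fun x => x *~ sg)); rewrite mzK mul0rz.
exists h, (subh (cmph h k') (cmph f k)); split=> // z.
have Pz : f (Psi j.+1 (Phi j.+1 z)) = h (Phi j.+1 z).2.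
  rewrite /h !homE; congr (f (Psi _ _)).
  by rewrite [LHS]surjective_pairing [(Phi j.+1 z).1]Qd.
have := congr1 f (kl z); rewrite Pz kl' !homD hz fz !addr0 homE => e.
by rewrite addrA e !homE addrK.
Qed.

(** Extended by zero to [T], [h] is a cocycle that becomes a coboundary along [Phi], hence factors
    through the differential of [T]. Restricting this to F needs Q_{j+1} = 0, one degree below what
    surjectivity needs; hence the stronger bound. *)
Lemma cap_inj_of_extension N j : (d <= j)%N -> cap_inj ec N j.
Proof.
move=> dj h g hz hg; have [lam [Phi [Psi [PhiS PsiS chE' _ PP]]]] := tail_equivalence.
have [k [l kl]] := PP j.
have [k' [l' kl']] := cap_comparison PhiS chE' j.
pose h' := cmph h (sndh (Q j.+2) (F j.+1)).
have h'd t : h' (aug_d (T lam) j.+1 t) = 0.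
  case: t => q z; rewrite [aug_d _ _ _]cone_dE.
  change (h (- (bdry j.+1 z *~ - sg)) = 0).
  by rewrite homN homMz hz mul0rz oppr0.
pose g' := subh (cmph (addh g (cmph h k')) (Psi j)) (cmph h' k).
exists (mzh (cmph g' (inr (Q j.+1) (F j))) sg) => z.
change (h z = g' (inr _ _ (bdry j z)) *~ sg).
rewrite -homMz -(homMz (inr _ _)) -chain_T; last exact: Qd.
have := congr1 h' (kl (inr _ _ z)); set t := inr _ _ z.
rewrite !homD h'd addr0.
have -> : h' (Phi j.+1 (Psi j.+1 t)) = h (Phi j.+1 (Psi j.+1 t)).2 by [].
rewrite kl' !homD hg hz addr0 [bdry _ _]PsiS // => e.
change (h' t = g (Psi j (aug_d (T lam) j t)) + h (k' (Psi j (aug_d (T lam) j t))) -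
  h' (k (aug_d (T lam) j t))).
by rewrite e addrK.
Qed.

End Periodicity.

(** * Modules of finite p-power exponent *)

Section PadicLevel.
Variables (p : nat) (p_pr : prime p).

Lemma Zp_expE k : (Zp_trunc (p ^ k.+1)).+2 = (p ^ k.+1)%N.
Proof. by rewrite Zp_cast // -(expn0 p) ltn_exp2l // prime_gt1. Qed.

Lemma padic_level_mod (x : padic p) d e :
  (d <= e)%N -> ((x e : nat) %% p ^ d.+1)%N = x d.
Proof.
move=> /subnK <-; elim: (e - d)%N => [|k IHk].
  by rewrite modn_small // -[X in (_ < X)%N]Zp_expE.
rewrite addSn -(modn_dvdm _ (dvdn_exp2l p (_ : d.+1 <= (k + d).+1)%N)).
  have xE : (x (k + d) : nat) = (x (k + d).+1 %% p ^ (k + d).+1)%N.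
    rewrite -val_Zp_nat -?(padic_coherent x (k + d)) //.
    by rewrite -(expn0 p) ltn_exp2l // prime_gt1.
  by rewrite -[in RHS]IHk xE.
by rewrite ltnS leq_addl.
Qed.

Lemma mulrn_modn (V : zmodType) (v : V) q k : v *+ q = 0 -> v *+ (k %% q) = v *+ k.
Proof. by move=> vq; rewrite [in RHS](divn_eq k q) mulrnDr mulnC mulrnA vq mul0rn add0r. Qed.

(** The exponent stored in a [ptMod] is only an upper bound and may differ between the two ends of a
    homomorphism. The p-adic action must therefore not depend on the level at which it is read. *)
Lemma mulrn_level (V : zmodType) (v : V) (x : padic p) d e :
  v *+ p ^ d = 0 -> v *+ p ^ e = 0 -> v *+ (x d : nat) = v *+ (x e : nat).
Proof.
wlog de : d e / (d <= e)%N => [IH|] vd ve.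
  by case: (leqP d e) => [/IH|/ltnW/IH] -> .
by rewrite -(padic_level_mod x de) mulrn_modn // expnSr mulrnA vd mul0rn.
Qed.

Lemma mulrn_modp (V : zmodType) (v : V) (x : padic p) e :
  v *+ p = 0 -> v *+ (padic_modp x : nat) = v *+ (x e : nat).
Proof.
move=> vp; rewrite -[RHS](mulrn_modn _ vp) -[X in (_ %% X)%N]expn1.
rewrite padic_level_mod // /padic_modp val_Fp_nat //.
by rewrite mulrn_modn.
Qed.

End PadicLevel.

Section FpModule.
Variables (p : nat) (p_pr : prime p) (G : groupType) (M : zgMod G).
Hypothesis Mp : forall x : M, x *+ p = 0.

Let mod (x : M) k : x *+ (k %% (Zp_trunc (pdiv p)).+2)%N = x *+ k.
Proof. by rewrite Fp_cast // mulrn_modn. Qed.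
(** The alias mentions [p_pr] and [Mp] so that the scalar action declared on it, which depends on
    both, can be inferred from the type. *)
Definition fp_car : Type := let _ := (p_pr, Mp) in M.
HB.instance Definition _ := GRing.Zmodule.copy fp_car (zg_car M).
Let scl (a : 'F_p) (x : fp_car) : fp_car := x *+ a.
Fact fp_scaleA a b x : scl a (scl b x) = scl (a * b) x.
Proof. by rewrite /scl /= [RHS]mod mulnC mulrnA. Qed.
Fact fp_scale1 : left_id 1 scl. Proof. by move=> x. Qed.
Fact fp_scaleDr : right_distributive scl +%R.
Proof. by move=> a x y; apply: mulrnDl. Qed.
Fact fp_scaleDl x : {morph scl^~ x : a b / a + b}.
Proof. by move=> a b; rewrite /scl /= [LHS]mod mulrnDr. Qed.
HB.instance Definition _ := GRing.Zmodule_isLmodule.Build 'F_p fp_car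
    fp_scaleA fp_scale1 fp_scaleDr fp_scaleDl.
Fact fp_actZ g a x : zg_act g (scl a x) = scl a (zg_act g x).
Proof. exact: zg_actMn. Qed.
Definition fp_mod : rgMod 'F_p G :=
  @RgMod 'F_p G fp_car (@zg_act G M) (@zg_act1 G M) (@zg_actM G M) (@zg_actD G M)
    fp_actZ.
End FpModule.

Section EquivariantLift.
Variables (G : groupType) (A B : zgMod G) (f : zgHom A B).

Lemma zhomD : {morph f : x y / x + y}. Proof. exact: raddfD. Qed.
Lemma zhomB : {morph f : x y / x - y}. Proof. exact: raddfB. Qed.
Lemma zhomMz z : {morph f : x / x *~ z}. Proof. by move=> x; apply: raddfMz. Qed.
Lemma zhomN : {morph f : x / - x}. Proof. exact: raddfN. Qed.
Lemma zhom0 : f 0 = 0. Proof. exact: raddf0. Qed.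

Lemma zhom_equivariant n (c : cochain n G A) :
  equivariant c -> equivariant ((fun x => f (c x)) : cochain n G B).
Proof. by move=> ec g x; rewrite ec zg_funG. Qed.

Lemma zhom_delta n (c : cochain n G A) :
  delta ((fun x => f (c x)) : cochain n G B) = fun x => f (delta c x).
Proof. by apply/funext => x; apply/esym/delta_additive/zhomD. Qed.

(** Tuples form a free [G]-set, with orbit representatives of first entry 1, so lifts can be chosen
    equivariantly. With [equivariant_corestrict], this turns a short exact sequence of coefficients
    into one of equivariant cochains. *)
Lemma equivariant_lift n (c : cochain n G B) : onto f -> equivariant c ->
  exists2 c' : cochain n G A, equivariant c' & (fun x => f (c' x)) = c.
Proof.
move=> fo ec; pose s y := projT1 (cid (fo (c y))).
have sE y : f (s y) = c y by rewrite /s; case: cid.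
exists (fun y => y ord0 ** s (fun i => (y ord0)^-1 * y i)%g).
  move=> g y; rewrite -zg_actM; congr (_ ** s _).
  by apply/funext => i; rewrite invgM -mulgA mulKg.
apply/funext => y; rewrite zg_funG sE -ec; congr c.
by apply/funext => i; rewrite mulVKg.
Qed.

Lemma equivariant_corestrict n (c : cochain n G B) : injective f ->
  (forall x, exists y, f y = c x) -> equivariant c ->
  exists2 c' : cochain n G A, equivariant c' & (fun x => f (c' x)) = c.
Proof.
move=> fi cf ec; pose s y := projT1 (cid (cf y)).
have sE y : f (s y) = c y by rewrite /s; case: cid.
exists s; last by apply/funext.
by move=> g y; apply: fi; rewrite zg_funG !sE ec.
Qed.

End EquivariantLift.

Section CupCochain.
Variables (p : nat) (p_pr : prime p) (G : groupType) (w : padic_char p G).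

Lemma pt_scale_hom (M N : ptMod p G) (f : zgHom M N) x m :
  f (pt_scale x m) = pt_scale x (f m).
Proof.
rewrite /pt_scale raddfMn; apply: mulrn_level => //; last exact: pt_kill.
by rewrite -raddfMn pt_kill raddf0.
Qed.

Fact twist_hom_subproof (M N : ptMod p G) (f : zgHom M N) :
  is_zhom (f : pt_twist p_pr M w -> pt_twist p_pr N w).
Proof.
split=> [|g x]; first exact: (zhomD f).
by rewrite /= -(zg_funG f); apply: pt_scale_hom.
Qed.
Definition twist_hom (M N : ptMod p G) (f : zgHom M N) :
  zgHom (pt_twist p_pr M w) (pt_twist p_pr N w) := mk_zhom (twist_hom_subproof f).

Variables (n : nat) (a : cochain n G (Zp_twist w)).
Hypotheses (ea : equivariant a) (da : delta a = 0).

Notation cupa := (cup_cochain p_pr a).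

Lemma cup_cochain_hom (M N : ptMod p G) (f : zgHom M N) j (c : cochain j G M) :
  cupa (fun x => f (c x)) = fun x => f (cupa c x).
Proof. by apply/funext => x; rewrite /cup_cochain pt_scale_hom. Qed.

Lemma cup_cochainD (M : ptMod p G) j (c d : cochain j G M) :
  cupa (c + d) = cupa c + cupa d.
Proof. by apply/funext => x; apply: pt_scaleDr. Qed.

Lemma cup_cochainB (M : ptMod p G) j (c d : cochain j G M) :
  cupa (c - d) = cupa c - cupa d.
Proof.
apply/eqP; rewrite eq_sym subr_eq -cup_cochainD; apply/eqP.
by rewrite subrK.
Qed.

Lemma cup_cochain0 (M : ptMod p G) j : cupa (0 : cochain j G M) = 0.
Proof. by rewrite -(subrr 0) cup_cochainB subrr. Qed.

(** The sign by which cup product with a cocycle of degree [n] fails to commute with [delta]. *)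
Definition sgn_cochain (M : zgMod G) j (c : cochain j G M) : cochain j G M :=
  fun x => c x *~ (-1) ^+ n.

Lemma sgn_cochain0 (M : zgMod G) j : sgn_cochain (0 : cochain j G M) = 0.
Proof. by apply/funext => x; apply: mul0rz. Qed.

Lemma sgn_equivariant (M : zgMod G) j (c : cochain j G M) :
  equivariant c -> equivariant (sgn_cochain c).
Proof. by move=> ec g x; rewrite /sgn_cochain ec zg_actMz. Qed.

Lemma sgn_delta (M : zgMod G) j (c : cochain j G M) :
  delta (sgn_cochain c) = sgn_cochain (delta c).
Proof.
apply/funext => x; rewrite /sgn_cochain /delta mulrz_suml.
by apply: eq_bigr => i _; rewrite -!mulrzA mulrC.
Qed.

Lemma sgnK (M : zgMod G) j (c : cochain j G M) : sgn_cochain (sgn_cochain c) = c.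
Proof. by apply/funext => x; rewrite /sgn_cochain -mulrzA -expr2 sqrr_sign. Qed.

Lemma sgn_cup (M : ptMod p G) j (c : cochain j G M) :
  cupa (sgn_cochain c) = sgn_cochain (cupa c).
Proof. by apply/funext => x; apply: pt_scaleMzr. Qed.

Lemma delta_cupa (M : ptMod p G) j (c : cochain j G M) :
  delta (cupa c) = sgn_cochain (cupa (delta c)) :> cochain (j + n).+1 G (pt_twist p_pr M w).
Proof.
apply/funext => x.
exact: (@delta_pair G (Zp_twist w) M (pt_twist p_pr M w) (fun u v => pt_scale u v)
  (fun y u v => pt_scaleDl p_pr u v y) (fun x u v => pt_scaleDr x u v)).
Qed.

Lemma cup_delta (M : ptMod p G) j (c : cochain j G M) :
  cupa (delta c) = delta (cupa (sgn_cochain c)) :> cochain (j + n).+1 G (pt_twist p_pr M w).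
Proof. by rewrite delta_cupa sgn_delta sgn_cup sgnK. Qed.

(** Together with [cup_inj]: bijectivity of [cup] in degree [j.+1], unfolded to cochains so that the
    diagram chases need neither quotients nor connecting homomorphisms. *)
Definition cup_surj (M : ptMod p G) j :=
  forall g : cochain (j.+1 + n) G (pt_twist p_pr M w), equivariant g -> delta g = 0 ->
  exists (f : cochain j.+1 G M) (h : cochain (j + n) G (pt_twist p_pr M w)),
    [/\ equivariant f, delta f = 0, equivariant h & g = cupa f + delta h].

Definition cup_inj (M : ptMod p G) j :=
  forall (f : cochain j.+1 G M) (h : cochain (j + n) G (pt_twist p_pr M w)),
    equivariant f -> delta f = 0 -> equivariant h -> cupa f = delta h ->
  exists2 k : cochain j G M, equivariant k & f = delta k.

Section FiveLemma.
Variables (M1 M M2 : ptMod p G) (i : zgHom M1 M) (q : zgHom M M2).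
Hypotheses (i_inj : injective i) (q_onto : onto q).
Hypothesis ex : forall x, q x = 0 <-> exists y, i y = x.

Let iw := twist_hom i.
Let qw := twist_hom q.

Let pull j (f : cochain j G M) : equivariant f -> (fun x => q (f x)) = 0 ->
  exists2 f' : cochain j G M1, equivariant f' & (fun x => i (f' x)) = f.
Proof.
move=> ef qf; apply: equivariant_corestrict => // x.
by apply/ex; apply: (congr1 (@^~ x) qf).
Qed.
Let pullw j (f : cochain j G (pt_twist p_pr M w)) :
  equivariant f -> (fun x => q (f x)) = 0 ->
  exists2 f' : cochain j G (pt_twist p_pr M1 w), equivariant f' & (fun x => i (f' x)) = f.
Proof.
move=> ef qf; apply: (@equivariant_corestrict _ _ _ iw) => // x.
by apply/ex; apply: (congr1 (@^~ x) qf).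
Qed.

Let inj_i (T : Type) (f g : T -> M1) : (fun x => i (f x)) = (fun x => i (g x)) -> f = g.
Proof. by move=> e; apply/funext => x; apply: i_inj; apply: (congr1 (@^~ x) e). Qed.

Lemma five_surj j : cup_surj M1 j -> cup_surj M2 j -> cup_inj M1 j.+1 -> cup_surj M j.
Proof.
move=> s1 s2 i1 g eg dg.
have [||f2 [h2 [ef2 df2 eh2 gE]]] := s2 (fun x => qw (g x)).
- exact: zhom_equivariant.
- by rewrite zhom_delta dg; apply/funext => x; apply: zhom0.
have [f ef fE] := equivariant_lift q_onto ef2.
have [h eh hE] := @equivariant_lift _ _ _ qw _ _ q_onto eh2.
pose g1 : cochain (j.+1 + n) G (pt_twist p_pr M w) := g - cupa f - delta h.
have eg1 : equivariant g1.
  apply: equivariantB; last exact: delta_equivariant.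
  by apply: equivariantB => //; apply: cup_equivariant.
have qg1 : (fun x => q (g1 x)) = 0.
  apply/funext => x; rewrite /g1 [LHS](_ : _ = q (g x) - q (cupa f x) - q (delta h x)).
    have -> : q (g x) = cupa f2 x + delta h2 x by rewrite -[RHS]/((cupa f2 + delta h2) x) -gE.
    rewrite -[q (cupa f x)](congr1 (@^~ x) (cup_cochain_hom q f)) fE.
    rewrite -[q (delta h x)](congr1 (@^~ x) (zhom_delta qw h)) hE.
    by rewrite addrAC addrK subrr.
  by rewrite -!zhomB.
have [g1' eg1' g1E] := pullw eg1 qg1.
(* [t] represents the connecting image of the class of [f2]. Its cup product with [a] turns out to
   be a coboundary ([ct]), so injectivity for [M1] one degree up makes [t] itself a coboundary. *)
have [|t et tE] := pull (delta_equivariant ef).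
  by rewrite -zhom_delta fE df2.
have dt : delta t = 0.
  apply: inj_i; rewrite -zhom_delta tE delta_delta.
  by apply/funext => x; rewrite zhom0.
have dg1 : delta g1 = - delta (cupa f).
  by rewrite /g1 !deltaB dg sub0r delta_delta subr0.
have ct : cupa t = delta (- sgn_cochain g1').
  apply: inj_i; rewrite -cup_cochain_hom tE cup_delta sgn_cup sgn_delta.
  rewrite -[RHS](zhom_delta iw).
  have -> : (fun x => iw ((- sgn_cochain g1') x)) = - sgn_cochain g1.
    apply/funext => x; rewrite -g1E.
    by apply: (etrans (zhomN iw _)); congr (- _); apply: (zhomMz iw).
  rewrite deltaN sgn_delta dg1; apply/funext => x.
  by rewrite /sgn_cochain -[RHS]mulNrz opprK.
have [k ek tk] := i1 t _ et dt (equivariantN (sgn_equivariant eg1')) ct.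
pose ik : cochain j.+1 G M := fun x => i (k x).
have eik : equivariant ik by apply: zhom_equivariant.
have df1 : delta (f - ik) = 0.
  by rewrite deltaB (zhom_delta i) -tk tE subrr.
(* The cochain [f - ik] is a cocycle that still lifts [f2], so what it leaves of [g] has values in
   [M1] and falls under surjectivity for [M1]. *)
pose g2 := g1' + cupa k.
have g2E : (fun x => i (g2 x)) = g - cupa (f - ik) - delta h.
  have -> : (fun x => i (g2 x)) = (fun x => i (g1' x)) + (fun x => i (cupa k x)).
    by apply/funext => x; apply: zhomD.
  rewrite g1E -cup_cochain_hom cup_cochainB /g1 opprB addrAC -[g - _ + _]addrA.
  by rewrite [- cupa f + _]addrC.
have [||f3 [h3 [ef3 df3 eh3 g2E']]] := s1 g2.
- apply: equivariantD => //; exact: cup_equivariant.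
- apply: inj_i; rewrite -[LHS](zhom_delta iw) g2E !deltaB dg sub0r delta_delta subr0.
  rewrite delta_cupa df1 cup_cochain0 sgn_cochain0 oppr0.
  by apply/funext => x; rewrite zhom0.
exists (f - ik + (fun x => i (f3 x))), (h + (fun x => iw (h3 x))); split.
- apply: equivariantD; first exact: equivariantB.
  exact: zhom_equivariant.
- rewrite deltaD df1 add0r (zhom_delta i) df3.
  by apply/funext => x; apply: zhom0.
- by apply: equivariantD => //; apply: (zhom_equivariant iw).
rewrite cup_cochainD deltaD cup_cochain_hom (zhom_delta iw).
have := g2E; rewrite g2E'.
have -> : (fun x => i ((cupa f3 + delta h3) x)) =
    (fun x => i (cupa f3 x)) + (fun x => iw (delta h3 x)).
  by apply/funext => x; apply: zhomD.
move=> /esym/eqP; rewrite !subr_eq => /eqP ->.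
by rewrite [RHS]addrACA -addrA addrC [delta h + _]addrC.
Qed.

Lemma five_inj j : cup_inj M1 j.+1 -> cup_inj M2 j.+1 -> cup_surj M2 j ->
  cup_inj M j.+1.
Proof.
move=> i1 i2 s2 f h ef df eh fh.
have [||||u2 eu2 fu] := i2 (fun x => q (f x)) (fun x => qw (h x)).
- exact: zhom_equivariant.
- by rewrite (zhom_delta q) df; apply/funext => x; apply: zhom0.
- exact: zhom_equivariant.
- by rewrite cup_cochain_hom fh (zhom_delta qw).
have [u eu uE] := equivariant_lift q_onto eu2.
pose h1 : cochain (j.+1 + n) G (pt_twist p_pr M w) := h - cupa (sgn_cochain u).
have eh1 : equivariant h1.
  by apply: equivariantB => //; apply/cup_equivariant/sgn_equivariant.
have dh1 : delta h1 = cupa (f - delta u) by rewrite deltaB -fh cup_cochainB cup_delta.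
have qf1 : (fun x => q ((f - delta u) x)) = 0.
  rewrite (_ : (fun x => _) = (fun x => q (f x)) - (fun x => q (delta u x))).
    by rewrite fu -(zhom_delta q) uE subrr.
  by apply/funext => x; apply: zhomB.
(* Modulo [M1] the cochain [h1] has become a cocycle. Surjectivity for [M2], one degree lower,
   allows it to be corrected until it takes values in [M1], like the cocycle [f3]. *)
have [||v2 [w2 [ev2 dv2 ew2 hE]]] := s2 (fun x => qw (h1 x)).
- exact: zhom_equivariant.
- rewrite (zhom_delta qw) dh1.
  have qc := cup_cochain_hom q (f - delta u); rewrite qf1 cup_cochain0 in qc.
  exact: esym qc.
have [v ev vE] := equivariant_lift q_onto ev2.
have [y ey yE] := @equivariant_lift _ _ _ qw _ _ q_onto ew2.
pose h2 : cochain (j.+1 + n) G (pt_twist p_pr M w) := h1 - cupa v - delta y.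
have [||h3 eh3 h3E] := @pullw _ h2.
- apply: equivariantB; last exact: delta_equivariant.
  by apply: equivariantB => //; apply: cup_equivariant.
- rewrite (_ : (fun x => _) = (fun x => qw (h1 x)) - (fun x => q (cupa v x)) -
      (fun x => qw (delta y x))).
    rewrite hE -(cup_cochain_hom q) vE -(zhom_delta qw) yE.
    by rewrite addrAC addrK subrr.
  by apply/funext => x; rewrite [LHS]zhomB zhomB.
pose f3 := f - delta u - delta (sgn_cochain v).
have ef3 : equivariant f3.
  apply: equivariantB; last exact/delta_equivariant/sgn_equivariant.
  by apply: equivariantB => //; apply: delta_equivariant.
have df3 : delta f3 = 0 by rewrite !deltaB df !delta_delta !subr0.
have [||f4 ef4 f4E] := @pull _ f3 => //.
- rewrite (_ : (fun x => _) = (fun x => q ((f - delta u) x)) -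
      (fun x => q (delta (sgn_cochain v) x))).
    rewrite qf1 -(zhom_delta q) sub0r (_ : (fun x => _) = sgn_cochain v2).
      by rewrite sgn_delta dv2 sgn_cochain0 oppr0.
    by rewrite -vE; apply/funext => x; apply: zhomMz.
  by apply/funext => x; apply: zhomB.
have [||||k ek f4k] := i1 f4 h3 => //.
- apply: inj_i; rewrite -(zhom_delta i) f4E df3.
  by apply/funext => x; rewrite zhom0.
- apply: inj_i; rewrite -(cup_cochain_hom i) f4E -[RHS](zhom_delta iw) h3E.
  by rewrite /f3 cup_cochainB -dh1 cup_delta sgnK !deltaB delta_delta subr0.
exists ((fun x => i (k x)) + sgn_cochain v + u).
  apply: equivariantD => //; apply: equivariantD; last exact: sgn_equivariant.
  exact: zhom_equivariant.
by rewrite !deltaD (zhom_delta i) -f4k f4E /f3 !subrK.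
Qed.
End FiveLemma.
End CupCochain.

(** * Reduction to modules killed by p *)

Section TorsionInduction.
Variables (p : nat) (p_pr : prime p) (G : groupType).

Section QuotientHom.
Variables (M : zgMod G) (S : M -> Prop).
Hypotheses (S0 : S 0) (SB : forall x y, S x -> S y -> S (x - y)).
Hypothesis (SG : forall g x, S x -> S (g ** x)).
Fact zg_quo_pi_subproof : is_zhom (zq_pi S0 SB : M -> zg_quo S0 SB SG).
Proof.
by split=> [x y|g x]; [exact: zq_piD | exact/esym/(zq_act_pi S0 SB SG)].
Qed.
Definition zg_quo_pi : zgHom M (zg_quo S0 SB SG) := mk_zhom zg_quo_pi_subproof.
Lemma zg_quo_onto : onto zg_quo_pi.
Proof. by move=> q; exists (zq_repr q); apply: zq_reprK. Qed.
Lemma zg_quo_pi0 x : zg_quo_pi x = 0 <-> S x.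
Proof. by rewrite -(zhom0 zg_quo_pi) [_ = _]zq_piP subr0. Qed.
End QuotientHom.

Section Devissage.
Variables (M : zgMod G) (e : nat).
Hypothesis kill : forall x : M, x *+ p ^ e.+1 = 0.

Let S x := x *+ p = 0 :> M.
Let S0 : S 0. Proof. exact: mul0rn. Qed.
Let SB x y : S x -> S y -> S (x - y).
Proof. by rewrite /S mulrnBl => -> ->; rewrite subrr. Qed.
Let SG g x : S x -> S (g ** x).
Proof. by rewrite /S -zg_actMn => ->; apply: zg_act0. Qed.
Let pi := zg_quo_pi S0 SB SG.

Fact sub_kill (q : zg_quo S0 SB SG) : q *+ p ^ e = 0.
Proof.
have [x <-] := zg_quo_onto q.
by rewrite -(raddfMn pi); apply/zg_quo_pi0; rewrite /S -mulrnA -expnSr.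
Qed.
(* p M, presented as M / M[p]. *)
Definition p_multiples : ptMod p G := PtMod sub_kill.

Let inc (q : p_multiples) : M := zq_repr q *+ p.
Let inc_pi x : inc (pi x) = x *+ p.
Proof.
apply/eqP; rewrite -subr_eq0 -mulrnBl; apply/eqP/(zq_piP S0 SB).
exact: zq_reprK.
Qed.
Fact inc_subproof : is_zhom inc.
Proof.
split=> [q r|g q].
  have [[x <-] [y <-]] := (zg_quo_onto q, zg_quo_onto r).
  by rewrite -(raddfD pi) !inc_pi mulrnDl.
have [x <-] := zg_quo_onto q.
by rewrite -(zg_funG pi) !inc_pi zg_actMn.
Qed.
Definition p_multiples_inc : zgHom p_multiples M := mk_zhom inc_subproof.
Lemma p_multiples_inj : injective p_multiples_inc.
Proof.
move=> q r; have [[x <-] [y <-]] := (zg_quo_onto q, zg_quo_onto r).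
rewrite [LHS]inc_pi [RHS]inc_pi => /eqP; rewrite -subr_eq0 -mulrnBl => /eqP xy.
exact/(zq_piP S0 SB).
Qed.

Let T (x : M) := exists y, y *+ p = x.
Let T0 : T 0. Proof. by exists 0; apply: mul0rn. Qed.
Let TB x y : T x -> T y -> T (x - y).
Proof. by case=> u <- [v <-]; exists (u - v); rewrite mulrnBl. Qed.
Let TG g x : T x -> T (g ** x).
Proof. by case=> u <-; exists (g ** u); rewrite zg_actMn. Qed.

Lemma mod_p_kill (q : zg_quo T0 TB TG) : q *+ p = 0.
Proof.
have [x <-] := zg_quo_onto q; rewrite -(raddfMn (zg_quo_pi T0 TB TG)).
by apply/zg_quo_pi0; exists x.
Qed.
Definition mod_p : ptMod p G :=
  @PtMod p G (zg_quo T0 TB TG) 1 mod_p_kill.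
Definition mod_p_pi : zgHom M mod_p := zg_quo_pi T0 TB TG.
Lemma mod_p_onto : onto mod_p_pi. Proof. exact: zg_quo_onto. Qed.
Lemma mod_p_exact x : mod_p_pi x = 0 <-> exists q, p_multiples_inc q = x.
Proof.
rewrite [_ = _]zg_quo_pi0; split=> [[y yE]|[q <-]].
  by exists (pi y); rewrite [LHS]inc_pi.
by exists (zq_repr q).
Qed.
End Devissage.

Variables (w : padic_char p G) (n : nat) (a : cochain n G (Zp_twist w)).
Hypotheses (ea : equivariant a) (da : delta a = 0).

Lemma cup_iso_torsion D :
  (forall M : ptMod p G, (forall x : M, x *+ p = 0) -> forall j, (D <= j)%N ->
     cup_surj p_pr a M j /\ cup_inj p_pr a M j.+1) ->
  forall M j, (D <= j)%N -> cup_surj p_pr a M j /\ cup_inj p_pr a M j.+1.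
Proof.
move=> base M; move: {2}(pt_exp M) (erefl (pt_exp M)) => e.
elim: e M => [|e IHe] M eM j Dj.
  (* Exponent 0 means that [M] is zero, in particular killed by [p]. *)
  by apply: base => // x; have := pt_kill x; rewrite eM expn0 mulr1n => ->; apply: mul0rn.
have kill (x : M) : x *+ p ^ e.+1 = 0 by rewrite -eM pt_kill.
have := IHe (p_multiples kill) (erefl e).
have := base (mod_p M) (@mod_p_kill M).
move=> /[dup] /(_ j Dj)[s2 i2] _.
move=> /[dup] /(_ j Dj)[s1 i1] _; split.
  apply: (five_surj ea da (@p_multiples_inj M e kill) (@mod_p_onto M)) => //.
  exact: mod_p_exact.
apply: (five_inj ea da (@p_multiples_inj M e kill) (@mod_p_onto M)) => //.
exact: mod_p_exact.
Qed.
End TorsionInduction.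

(** * Modules killed by p as modules over F_p[G] *)

Section FpLink.
Variables (p : nat) (p_pr : prime p) (G : groupType) (w : padic_char p G).
Hypothesis w1 : trivial_modp w.
Variables (n : nat) (a : cochain n G (Zp_twist w)).
Hypotheses (ea : equivariant a) (da : delta a = 0).

Definition modp_cochain : cochain n G (rg_zg (triv_mod 'F_p G)) :=
  fun x => modp_hom w1 (a x).
Lemma modp_equivariant : equivariant modp_cochain.
Proof. exact: zhom_equivariant. Qed.
Lemma modp_delta : delta modp_cochain = 0.
Proof. by rewrite zhom_delta da; apply/funext => x; apply: zhom0. Qed.

Variables (M : ptMod p G) (Mp : forall x : M, x *+ p = 0).
Let N : rgMod 'F_p G := fp_mod p_pr Mp.

Lemma pt_scale_modp (x : padic p) (m : M) : pt_scale x m = m *+ (padic_modp x : nat).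
Proof. by rewrite (mulrn_modp p_pr x (pt_exp M)). Qed.

Fact to_fp_subproof : is_zhom (id : M -> rg_zg N). Proof. by []. Qed.
Fact of_fp_subproof : is_zhom (id : rg_zg N -> M). Proof. by []. Qed.
(** On a module killed by [p] the character acts through its reduction, which is 1; hence the
    identity map is equivariant between the twisted and the untwisted module. *)
Fact twist_to_fp_subproof : is_zhom (id : pt_twist p_pr M w -> rg_zg N).
Proof. by split=> // g x; rewrite /= pt_scale_modp w1 mulr1n. Qed.
Fact twist_of_fp_subproof : is_zhom (id : rg_zg N -> pt_twist p_pr M w).
Proof. by split=> // g x; rewrite /= pt_scale_modp w1 mulr1n. Qed.
Let toN := mk_zhom to_fp_subproof.
Let ofN := mk_zhom of_fp_subproof.
Let toNw := mk_zhom twist_to_fp_subproof.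
Let ofNw := mk_zhom twist_of_fp_subproof.

Lemma scale_cup_modp j (f : cochain j G M) :
  scale_cup modp_cochain (f : cochain j G (rg_zg N)) = cup_cochain p_pr a f.
Proof. by apply/funext => x; rewrite /cup_cochain pt_scale_modp. Qed.

Lemma cup_surj_of_cap j : cap_surj modp_equivariant N j -> cup_surj p_pr a M j.
Proof.
move=> cs g eg dg.
have eg' : equivariant ((fun x => toNw (g x)) : cochain _ G _) by apply: zhom_equivariant.
have [z|h [k [hz hE]]] := cs (fr_lift eg').
  move: z; apply: (@fr_ext _ _ _ _ (cmph (fr_lift eg') (bdry _)) zeroh) => y.
  rewrite !homE hom_bdry (_ : (fun z => _) = (fun x => toNw (g x))).
    by rewrite zhom_delta dg.
  by apply/funext => z; rewrite fr_liftE.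
exists (fun y => ofN (h (bas y))), (fun y => ofNw (k (bas y))); split.
- exact/zhom_equivariant/hom_equivariant.
- rewrite (zhom_delta ofN); apply/funext => y.
  by rewrite -hom_bdry hz.
- exact/(zhom_equivariant ofNw)/hom_equivariant.
apply/funext => y; have := hE (bas y); rewrite fr_liftE hom_cap hom_bdry.
by rewrite (scale_cup_modp (fun z => h (bas z))) (zhom_delta ofNw).
Qed.

Lemma cup_inj_of_cap j : cap_inj modp_equivariant N j -> cup_inj p_pr a M j.
Proof.
move=> ci f h ef df eh fh.
have ef' : equivariant ((fun x => toN (f x)) : cochain _ G _) by apply: zhom_equivariant.
have eh' : equivariant ((fun x => toNw (h x)) : cochain _ G _) by apply: zhom_equivariant.
have [z|z|k kE] := ci (fr_lift ef') (fr_lift eh').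
- move: z; apply: (@fr_ext _ _ _ _ (cmph (fr_lift ef') (bdry _)) zeroh) => y.
  rewrite !homE hom_bdry (_ : (fun z => _) = (fun x => toN (f x))).
    by rewrite zhom_delta df.
  by apply/funext => z; rewrite fr_liftE.
- move: z; apply: (@fr_ext _ _ _ _ (cmph (fr_lift ef') (cap _ _))
    (cmph (fr_lift eh') (bdry _))) => y.
  rewrite !homE hom_cap hom_bdry.
  rewrite (_ : (fun z => _) = (fun x => toN (f x))); last first.
    by apply/funext => z; rewrite fr_liftE.
  rewrite (_ : (fun z => fr_lift eh' _) = (fun x => toNw (h x))); last first.
    by apply/funext => z; rewrite fr_liftE.
  by rewrite [LHS](congr1 (@^~ y) (scale_cup_modp f)) zhom_delta fh.
exists (fun y => ofN (k (bas y))); first exact/zhom_equivariant/hom_equivariant.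
rewrite (zhom_delta ofN); apply/funext => y; have := kE (bas y).
by rewrite fr_liftE hom_bdry.
Qed.

End FpLink.

Section PeriodicOfCup.
Variables (p : nat) (p_pr : prime p) (G : groupType) (w : padic_char p G) (n : nat).

Lemma bijective_of_cup (a : cocycle (Zp_twist w) n.+1) (M : ptMod p G) j :
  cup_surj p_pr a M j -> cup_inj p_pr a M j ->
  bijective (@cup p p_pr G M w n.+1 j.+1 (cls a)).
Proof.
move=> cs ci.
have inj : injective (@cup p p_pr G M w n.+1 j.+1 (cls a)).
  move=> x y; rewrite -(cls_reprK x) -(cls_reprK y) !cup_cls => /cls_eqP[h eh hE].
  have /asboolP[ex dx] := cocycleP (cls_repr x).
  have /asboolP[ey dy] := cocycleP (cls_repr y).
  apply/cls_eqP; have [||||k ek kE] := ci (cocycle_val (cls_repr x) - cls_repr y) h => //.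
  - exact: equivariantB.
  - by rewrite deltaB dx dy subrr.
  - by rewrite cup_cochainB.
  by exists k.
have sur y : exists x, @cup p p_pr G M w n.+1 j.+1 (cls a) x = y.
  have /asboolP[ey dy] := cocycleP (cls_repr y).
  have [f [h [ef df eh fE]]] := cs _ ey dy.
  have fP : f \in @cocycle_pred G M j.+1 by apply/asboolP.
  exists (cls (Cocycle fP)); rewrite cup_cls -[RHS]cls_reprK; apply/cls_eqP.
  exists (- h); first exact: equivariantN.
  by rewrite /= fE deltaN opprD addrA subrr sub0r.
exists (fun y => projT1 (cid (sur y))) => [x|y]; last by case: cid.
by apply: inj; case: cid.
Qed.

End PeriodicOfCup.

(** * From extensions to periodicity *)

Section PeriodicOfExtension.
Variables (p : nat) (p_pr : prime p) (G : groupType) (w : padic_char p G).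

Lemma periodic_of_extension m (E : extension p G m)
    (x : cohomology (rg_zg (triv_mod 'F_p G)) m.+2) :
  (forall i, (i <= m)%N -> projective (ext_P E i)) ->
  (exists d, projdim_le (ext_A E) d) -> ext_class E x -> omega_p_integral w x ->
  periodic_via p_pr w.
Proof.
move=> pP [d [Q [pQ oQ exQ Qd]]].
move=> [phi [phiA [c [[ephi ephiA] phi0 phiS phiAE [chE cx]]]]] [w1 [y yx]].
pose a := cls_repr y.
have /asboolP[ea da] := cocycleP a; have /asboolP[ec dc] := cocycleP c.
(* [x] is both the Yoneda class, represented by [c], and the reduction of the p-adic class of [a];
   hence the two cocycles differ by a coboundary. *)
have [b eb bE] : exists2 b : cochain m.+1 G (rg_zg (triv_mod 'F_p G)),
    equivariant b & modp_cochain w1 a - c = delta b.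
  by move: cx; rewrite -yx -(cls_reprK y) cohom_map_cls => /esym/cls_eqP.
have cap_iso N j : (d <= j)%N -> cap_surj (modp_equivariant w1 ea) N j /\
    cap_inj (modp_equivariant w1 ea) N j.
  move=> dj.
  have h0 z : aug_eps (ext_P E) (fr_lift (ephi 0%N) z) = std_aug z.
    move: z; apply: (@fr_ext _ _ _ _ (cmph (aug_eps _) (fr_lift (ephi 0%N))) std_aug) => z.
    by rewrite homE !fr_liftE phi0.
  have hS i : (i < m)%N -> forall z, aug_d (ext_P E) i (fr_lift (ephi i.+1) z) =
      fr_lift (ephi i) (bdry i z).
    move=> im; apply: (@fr_ext _ _ _ _ (cmph (aug_d _ i) (fr_lift (ephi i.+1)))
      (cmph (fr_lift (ephi i)) (bdry i))) => z.
    rewrite !homE fr_liftE hom_bdry phiS // (_ : (fun z => _) = phi i) //.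
    by apply/funext => t; rewrite fr_liftE.
  have hA z : ext_d E (fr_lift ephiA z) = fr_lift (ephi m) (bdry m z).
    move: z; apply: (@fr_ext _ _ _ _ (cmph (ext_d E) (fr_lift ephiA))
      (cmph (fr_lift (ephi m)) (bdry m))) => z.
    rewrite !homE fr_liftE hom_bdry phiAE // (_ : (fun z => _) = phi m) //.
    by apply/funext => t; rewrite fr_liftE.
  have hc z : ext_i E (fr_lift ec z) = fr_lift ephiA (bdry m.+1 z).
    move: z; apply: (@fr_ext _ _ _ _ (cmph (ext_i E) (fr_lift ec))
      (cmph (fr_lift ephiA) (bdry m.+1))) => z.
    rewrite !homE fr_liftE hom_bdry chE // (_ : (fun z => _) = phiA) //.
    by apply/funext => t; rewrite fr_liftE.
  have cE z : fr_lift ec z = fr_lift (modp_equivariant w1 ea) z +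
      fr_lift (equivariantN eb) (bdry m.+1 z).
    move: z; apply: (@fr_ext _ _ _ _ (fr_lift ec) (addh (fr_lift _)
      (cmph (fr_lift (equivariantN eb)) (bdry m.+1)))) => z.
    rewrite !homE hom_bdry !fr_liftE (_ : (fun z => _) = - b).
      by rewrite deltaN -bE opprB [X in _ + X](_ : _ = c z - modp_cochain w1 a z) // addrC subrK.
    by apply/funext => t; rewrite fr_liftE.
  by split; [apply: (cap_surj_of_extension (@ext_exact _ _ _ E) (@ext_exactP _ _ _ E)
      (@ext_exactA _ _ _ E) (@ext_inj _ _ _ E) pP pQ oQ exQ h0 hS hA hc
      (modp_delta w1 da) cE Qd (leqW dj))
    | apply: (cap_inj_of_extension (@ext_exact _ _ _ E) (@ext_exactP _ _ _ E)
      (@ext_exactA _ _ _ E) (@ext_inj _ _ _ E) pP pQ oQ exQ h0 hS hA hc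
      (modp_delta w1 da) cE Qd dj)].
(* For [j] at least [d], [cup_iso_torsion] yields injectivity at index j + 1, that is, in degree j +
   2; hence the bound d + 2. *)
exists d.+2, m.+2, (cls a); split=> // -[|[|j]] // dj M.
have tors := cup_iso_torsion ea da (D := d) (fun M Mp j dj => conj
  (cup_surj_of_cap (cap_iso (fp_mod p_pr Mp) j dj).1)
  (cup_inj_of_cap (cap_iso (fp_mod p_pr Mp) j.+1 (leqW dj)).2)).
by apply: bijective_of_cup; [apply: (tors M j.+1 (leqW dj)).1 | apply: (tors M j dj).2].
Qed.

End PeriodicOfExtension.

(** * Products of periodicity classes *)

Section Recast.
Variables (G : groupType) (M : zgMod G).

(** Iterated cup products land in degree (j + n2) + n1, the product class in degree j + (n2 + n1).
    These are equal but not convertible, so cochains have to be transported. *)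
Definition recast N1 N2 (e : N1 = N2) (f : cochain N1 G M) : cochain N2 G M :=
  fun x => f (fun k => x (cast_ord (congr1 S e) k)).

Lemma recast_id N (e : N = N) (f : cochain N G M) : recast e f = f.
Proof.
by apply/funext => x; congr f; apply/funext => k; rewrite cast_ord_id.
Qed.

Lemma recastK N1 N2 (e : N1 = N2) (e' : N2 = N1) f : recast e' (recast e f) = f.
Proof. by subst N2; rewrite !recast_id. Qed.

Lemma recast_res N1 N2 (e : N1 = N2) f y : recast e f (@res G N2 y) = f (@res G N1 y).
Proof. by subst N2; rewrite recast_id. Qed.

Lemma recast_equivariant N1 N2 (e : N1 = N2) f : equivariant f -> equivariant (recast e f).
Proof. by subst N2; rewrite recast_id. Qed.

Lemma recast_delta N1 N2 (e : N1 = N2) (e' : N1.+1 = N2.+1) f :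
  delta (recast e f) = recast e' (delta f).
Proof. by subst N2; rewrite !recast_id. Qed.

Lemma recastD N1 N2 (e : N1 = N2) f g : recast e (f + g) = recast e f + recast e g.
Proof. by subst N2; rewrite !recast_id. Qed.
End Recast.

Section CupIso.
Variables (p : nat) (p_pr : prime p) (G : groupType).

Definition cup_iso (w : padic_char p G) n (a : cochain n G (Zp_twist w)) k :=
  forall (M : ptMod p G) j, (k <= j.+1)%N -> cup_surj p_pr a M j /\ cup_inj p_pr a M j.

Lemma cup_iso_of_bijective (w : padic_char p G) n (a : cocycle (Zp_twist w) n) k :
  (forall i, (k <= i)%N -> forall M : ptMod p G,
     bijective (@cup p p_pr G M w n i (cls a))) -> cup_iso a k.
Proof.
move=> bij M j kj; have [inv invK invK'] := bij _ kj M; split.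
  move=> g eg dg; have gP : g \in @cocycle_pred G (pt_twist p_pr M w) (j.+1 + n).
    by apply/asboolP.
  pose f := cls_repr (inv (cls (Cocycle gP))).
  have : cls (Cocycle gP) = cls (cup_cocycle p_pr a f).
    by rewrite -cup_cls cls_reprK invK'.
  have /asboolP[ef df] := cocycleP f.
  move=> /cls_eqP[h eh hE]; exists f, h; split=> //.
  by apply/eqP; rewrite addrC -subr_eq; apply/eqP.
move=> f h ef df eh fh.
have fP : f \in @cocycle_pred G M j.+1 by apply/asboolP.
have : @cup p p_pr G M w n j.+1 (cls a) (cls (Cocycle fP)) = cup p_pr (cls a) (cls 0).
  rewrite !cup_cls; apply/cls_eqP; exists h => //.
  have e0 : cup_cochain p_pr a (0 : cocycle M j.+1) = 0 by rewrite cocycle_val0 cup_cochain0.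
  exact: (etrans (congr1 (fun z => cup_cochain p_pr a f - z) e0) (etrans (subr0 _) fh)).
move=> /(can_inj invK)/cls_eqP[k0 ek0 kE]; exists k0 => //.
apply: etrans kE; apply: esym.
exact: (etrans (congr1 (fun z => f - z) (cocycle_val0 M j.+1)) (subr0 _)).
Qed.

Section Product.
Variables w1 w2 : padic_char p G.

Fact prod_char_unit g : w1 g * w2 g \is a GRing.unit.
Proof. by rewrite unitrM !pchar_unit. Qed.
Fact prod_charM g h : w1 (g * h)%g * w2 (g * h)%g = (w1 g * w2 g) * (w1 h * w2 h).
Proof. by rewrite !pcharM mulrACA. Qed.
Definition prod_char : padic_char p G := PadicChar prod_char_unit prod_charM.

Variables (n1 n2 : nat).
Variables (a1 : cochain n1 G (Zp_twist w1)) (a2 : cochain n2 G (Zp_twist w2)).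
Hypotheses (ea1 : equivariant a1) (da1 : delta a1 = 0).
Hypotheses (ea2 : equivariant a2) (da2 : delta a2 = 0).

Definition padic_mulp (u : Zp_twist w1) (v : Zp_twist w2) : Zp_twist prod_char :=
  (u : padic p) * (v : padic p).

Lemma padic_mulpDl v : {morph padic_mulp^~ v : u u' / u + u'}.
Proof. by move=> u u'; apply: mulrDl. Qed.
Lemma padic_mulpDr u : {morph padic_mulp u : v v' / v + v'}.
Proof. by move=> v v'; apply: mulrDr. Qed.

Definition prod_cochain : cochain (n2 + n1) G (Zp_twist prod_char) :=
  pair_cochain padic_mulp a1 a2.

Lemma prod_equivariant : equivariant prod_cochain.
Proof.
move=> g x; rewrite /prod_cochain /pair_cochain /padic_mulp.
by rewrite (ea1 g (fun k => x (inord k))) ea2 /= mulrACA.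
Qed.

Lemma prod_delta : delta prod_cochain = 0.
Proof.
apply/funext => x; rewrite /prod_cochain.
rewrite (delta_pair padic_mulpDl padic_mulpDr) //.
by rewrite da2 /pair_cochain /padic_mulp mulr0 mul0rz.
Qed.

Section Module.
Variable M : ptMod p G.
(** The twist is again p-torsion of finite exponent, so periodicity by [a1] may be applied with
    coefficients in it after [a2]. *)
Definition pt_twist_pt : ptMod p G :=
  @PtMod p G (pt_twist p_pr M w2) (pt_exp M) (@pt_kill p G M).
Let M2 := pt_twist_pt.

Fact twist_prod_subproof :
  is_zhom (id : pt_twist p_pr M2 w1 -> pt_twist p_pr M prod_char).
Proof. by split=> // g x; rewrite /= pt_scaleM. Qed.
Fact prod_twist_subproof :
  is_zhom (id : pt_twist p_pr M prod_char -> pt_twist p_pr M2 w1).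
Proof. by split=> // g x; rewrite /= pt_scaleM. Qed.
Let toP := mk_zhom twist_prod_subproof.
Let ofP := mk_zhom prod_twist_subproof.

(** The Alexander-Whitney product is associative already on cochains. Only the degree is
    transported, and twisting by w2 and then by w1 is twisting by the product character. *)
Lemma cup_prod j (f : cochain j G M) (e : (j + (n2 + n1) = (j + n2) + n1)%N) :
  recast e (cup_cochain p_pr prod_cochain f) =
  cup_cochain p_pr a1 (cup_cochain p_pr a2 f : cochain (j + n2) G M2).
Proof.
apply/funext => x; rewrite (resE x) recast_res !cup_res /prod_cochain pair_res.
rewrite pt_scaleM //; congr (pt_scale _ (pt_scale _ (f _))); apply/funext => k.
by rewrite /res addnA [(n2 + n1)%N]addnC.
Qed.
End Module.

Lemma cup_iso_prod k : cup_iso a1 k -> cup_iso a2 k -> cup_iso prod_cochain k.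
Proof.
move=> i1 i2 M j kj; pose M2 := pt_twist_pt M.
pose toP := mk_zhom (twist_prod_subproof M).
pose ofP := mk_zhom (prod_twist_subproof M).
have kj' : (k <= (j + n2).+1)%N by rewrite (leq_trans kj) // ltnS leq_addr.
have [s1 in1] := i1 M2 (j + n2)%N kj'; have [s2 in2] := i2 M j kj.
have e i : (i + (n2 + n1) = (i + n2) + n1)%N by rewrite addnA.
split.
  move=> g eg dg; pose g' := recast (e j.+1) g.
  have [||f1 [h1 [ef1 df1 eh1 g'E]]] := s1 (fun x => ofP (g' x)).
  - by apply: (zhom_equivariant ofP); apply: recast_equivariant.
  - rewrite (zhom_delta ofP) (recast_delta _ (congr1 S (e j.+1))) dg.
    by apply/funext.
  have [f [h2 [ef df eh2 f1E]]] := s2 f1 ef1 df1.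
  (* Two coboundaries add up here: [h1], from the cup product with [a1], and the image of [h2],
     carried through that product by [cup_delta] at the cost of a sign. *)
  pose h : cochain ((j + n2) + n1) G (pt_twist p_pr M2 w1) :=
    cup_cochain p_pr a1 (sgn_cochain n1 h2 : cochain (j + n2) G M2) + h1.
  have eh : equivariant h.
    apply: equivariantD => //; apply: cup_equivariant => //.
    exact: sgn_equivariant.
  exists f, (recast (esym (e j)) ((fun x => toP (h x)) : cochain _ G _)); split=> //.
    by apply: recast_equivariant; apply: (zhom_equivariant toP).
  apply: (can_inj (recastK (e j.+1) (esym (e j.+1)))).
  rewrite recastD cup_prod -(recast_delta (e j)) recastK (zhom_delta toP).
  transitivity (cup_cochain p_pr a1 f1 + delta h1); first exact: g'E.
  rewrite f1E cup_cochainD -addrA; congr (_ + _).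
  transitivity (delta (cup_cochain p_pr a1 (sgn_cochain n1 h2 : cochain (j + n2) G M2)) +
    delta h1); last exact/esym/deltaD.
  by congr (_ + _); apply: (cup_delta p_pr da1 (M := M2)).
move=> f h ef df eh fh.
have /asboolP[ef2 df2] : cup_cochain p_pr a2 f \in @cocycle_pred G M2 (j.+1 + n2).
  apply/asboolP; split; first exact: cup_equivariant.
  by rewrite delta_cupa // df cup_cochain0 sgn_cochain0.
have [||k1 ek1 k1E] := in1 (cup_cochain p_pr a2 f)
    ((fun x => ofP (recast (e j) h x)) : cochain _ G _) ef2 df2.
- by apply: (zhom_equivariant ofP); apply: recast_equivariant.
- by rewrite -(cup_prod f (e j.+1)) fh (zhom_delta ofP) (recast_delta (e j) (e j.+1)).
exact: (in2 f k1 ef df ek1 k1E).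
Qed.
End Product.
End CupIso.

(** * From periodicity to extensions *)

Section ExtensionOfCocycle.
Variables (R : nzRingType) (G : groupType) (m : nat).
Notation F := (fr_mod R G).
Notation F1 := (triv_mod R G).
Variable c : cochain m.+2 G (rg_zg F1).
Hypotheses (ec : equivariant c) (dc : delta c = 0).
Let cc := fr_lift ec.

Lemma cocycle_bdry z : cc (bdry m.+2 z) = 0.
Proof.
move: z; apply: (@fr_ext _ _ _ _ (cmph cc (bdry m.+2)) zeroh) => y.
rewrite !homE hom_bdry (_ : (fun z => _) = c) ?dc //.
by apply/funext => z; rewrite fr_liftE.
Qed.

Let bb i (z : F i.+2) : bdry i (bdry i.+1 z) = 0.
Proof. exact: (@aug_dd _ _ _ (std R G) i.+1 z (@std_exact R G i.+1)). Qed.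

(* The pushout of F_{m+1} <- im (F_{m+2} -> F_{m+1}) -> R along the map
   induced by c. *)
Let rel (x : sum_mod F1 (F m.+1)) := exists z, x = (cc z, - bdry m.+1 z).
Fact rel0 : rel 0. Proof. by exists 0; rewrite !hom0 oppr0. Qed.
Fact relB x y : rel x -> rel y -> rel (x - y).
Proof.
by case=> z -> [t ->]; exists (z - t); rewrite !homB opprD.
Qed.
Fact relG g x : rel x -> rel (rg_act g x).
Proof.
by case=> z ->; exists (rg_act g z); rewrite !rg_funG -rg_actN.
Qed.
Fact relZ a x : rel x -> rel (a *: x).
Proof. by case=> z ->; exists (a *: z); rewrite !homZ -scalerN. Qed.

Definition pushout : rgMod R G := rg_quo rel0 relB relG relZ.
Let pi : rgHom (sum_mod F1 (F m.+1)) pushout := quo_pi rel0 relB relG relZ.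
Let pi_onto : onto pi.
Proof. by move=> q; exists (quo_repr q); apply: quo_reprK. Qed.

Definition pushout_in : rgHom F1 pushout := cmph pi (pairh (idh F1) zeroh).
Definition pushout_free : rgHom (F m.+1) pushout := cmph pi (pairh zeroh (idh _)).

Fact pushout_d_subproof x : rel x -> cmph (bdry m) (sndh F1 (F m.+1)) x = 0.
Proof.
case=> z ->; change (bdry m (- bdry m.+1 z) = 0).
by rewrite homN bb oppr0.
Qed.
Definition pushout_d : rgHom pushout (F m) :=
  quo_factor rel0 relB relG relZ pushout_d_subproof.
Lemma pushout_dE u z : pushout_d (pi (u, z)) = bdry m z.
Proof. exact: quo_factor_pi. Qed.

Lemma pushout_exactP (x : std R G m) :
  @aug_ker _ _ _ (std R G) m x <-> exists a, pushout_d a = x.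
Proof.
rewrite (@std_exact R G m x); split=> [[y <-]|[q <-]].
  by exists (pi (0, y)); rewrite pushout_dE.
by have [[u z] <-] := pi_onto q; exists z; rewrite pushout_dE.
Qed.

Lemma pushout_exactA a : pushout_d a = 0 <-> exists u, pushout_in u = a.
Proof.
split=> [|[u <-]]; last by rewrite [LHS]pushout_dE hom0.
have [[u z] <-] := pi_onto a; rewrite pushout_dE => e.
have [y yE] : exists y, bdry m.+1 y = z by apply/(@std_exact R G m.+1).
exists (u + cc y); apply/quo_piP; exists y.
congr (_, _); first by rewrite /= addrAC subrr add0r.
by rewrite yE; apply: sub0r.
Qed.

(** A relation identifying two elements of R is the value of [cc] on a cycle; cycles are boundaries,
    and [cc] kills these by the cocycle condition. *)
Lemma pushout_in_inj : injective pushout_in.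
Proof.
move=> u u' /quo_piP[y /= [e1 e2]]; apply/eqP; rewrite -subr_eq0; apply/eqP.
have /(@std_exact R G m.+2)[y' y'E] : bdry m.+1 y = 0.
  by apply: oppr_inj; rewrite -e2 subr0 oppr0.
by rewrite [LHS]e1 -y'E; apply: cocycle_bdry.
Qed.

Let sg := ((-1) ^+ m.+2 : int).
Let sgsg : sg * sg = 1. Proof. by rewrite /sg -expr2 sqrr_sign. Qed.
Let mzK (M : rgMod R G) (x : M) : x *~ sg *~ sg = x.
Proof. by rewrite -mulrzA sgsg. Qed.

Let C := std_shift R G m.+1.
Let D := scale_d (std R G) sg.
Let exC i : aug_exact C i. Proof. exact: std_shift_exact. Qed.
Let exD i : aug_exact D i.
Proof. by apply: scale_d_exact => //; apply: std_exact. Qed.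
Let capS : chain_map (C := C) (D := D) (fun=> True) (cap ec).
Proof. by move=> i _ z; rewrite [LHS](congr1 (fun t => t *~ sg) (cap_bdry ec dc z)) mzK. Qed.
Let K := cone (C := C) (D := D) (cap ec).

Let v : rgHom (sum_mod (F 0%N) (F m.+1)) pushout :=
  cmph pi (pairh (cmph std_aug (fsth _ _)) (sndh _ _)).
Let vE u z : v (u, z) = pi (std_aug u, z). Proof. by []. Qed.

(** By [cap_aug], applying [std_aug] to the first component turns the bottom differential (cap y, -
    bdry y) of the cone into the relation (c y, - bdry y) defining the pushout. *)
Lemma pushout_resolution_exact x : v x = 0 <-> exists y, aug_eps K y = x.
Proof.
case: x => u z; rewrite vE quo_pi0; split=> [[y [e1 e2]]|[[q y]]].
  have /(@std_exact R G 0)[q qE] : aug_eps (std R G) (u - cap ec 0 y) = 0.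
    by rewrite homB [X in X - _]e1 [X in _ - X](cap_aug ec) subrr.
  exists (q *~ sg, y); rewrite cone_augE; congr (_, _); last exact: esym.
  change (bdry 0 (q *~ sg) *~ sg + cap ec 0 y = u).
  by rewrite homMz mzK [bdry 0 q]qE subrK.
rewrite cone_augE => -[<- <-]; exists y; congr (_, _).
change (std_aug (bdry 0 q *~ sg + cap ec 0 y) = cc y).
rewrite homD (cap_aug ec) homMz.
by rewrite (@aug_dd _ _ _ (std R G) 0 q (@std_exact R G 0)) mul0rz add0r.
Qed.

Lemma pushout_projdim k :
  (forall N j, (k <= j)%N -> cap_surj ec N j /\ cap_inj ec N j) ->
  exists d, projdim_le pushout d.
Proof.
(* Term k + 2 of the spliced resolution is term k + 1 of the cone, the sum of F_{k+2} and
   F_{k+1+m+2}. A cocycle there is handled by injectivity at index k + 1 and surjectivity at index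
   k. *)
move=> iso; exists k.+2.
apply: (@projdim_of_vanish _ _ _ (splice K v) k.+1).
- case=> [|i] /=; apply: projective_sum; exact: fr_projective.
- move=> q; have [[u z] <-] := pi_onto q; have [t <-] := std_onto u.
  by exists (t, z).
- by apply: splice_exact; [apply: pushout_resolution_exact | move=> i; apply: cone_exact].
move=> M f fk.
have fd x : f (aug_d K k.+1 x) = 0.
  by apply: fk; apply: (@aug_dd _ _ _ K k.+1); apply: cone_exact.
pose al := cmph f (pairh (idh (F k.+2)) (zeroh : rgHom _ (F (k.+1 + m.+2)))).
pose be := cmph f (pairh (zeroh : rgHom _ (F k.+2)) (idh (F (k.+1 + m.+2)))).
have fE q z : f (q, z) = al q + be z.
  transitivity (f ((q, 0) + (0, z) : sum_mod (F k.+2) (F (k.+1 + m.+2)))).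
    by congr (f _); apply: injective_projections; rewrite /= ?addr0 ?add0r.
  exact: homD.
have rel' q z : al (bdry k.+2 q *~ sg + cap ec k.+2 z) = be (bdry (k.+1 + m.+2) z).
  have := fd (q, z); rewrite cone_dE fE homN => /eqP.
  by rewrite subr_eq0 => /eqP.
have al0 q : al (bdry k.+2 q) = 0.
  have := rel' (q *~ sg) 0; rewrite homMz mzK !hom0 addr0; exact.
(* By [rel'], the cup product of the cocycle [al] with [c] is the coboundary of [be]; injectivity
   makes [al] a coboundary. *)
have [|z|k0 k0E] := (iso M k.+1 (leqnSn k)).2 al be.
- exact: al0.
- by have := rel' 0 z; rewrite hom0 mul0rz add0r.
(* Once the contribution of [k0] is subtracted, [be] is a cocycle. Surjectivity writes it as a cup
   product plus a coboundary, which supplies the two components of the required map. *)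
have [|h [g [hz gE]]] := (iso M k (leqnn k)).1 (subh be (mzh (cmph k0 (cap ec k.+1)) sg)).
  move=> z; change (be (bdry (k.+1 + m.+2) z) -
    k0 (cap ec k.+1 (bdry (k.+1 + m.+2) z)) *~ sg = 0).
  have := rel' 0 z; rewrite hom0 mul0rz add0r => <-.
  by rewrite k0E cap_bdry // homMz subrr.
exists (subh (cmph (addh (mzh k0 sg) h) (fsth (F k.+1) (F (k + m.+2)))) (cmph g (sndh _ _))).
case=> q z; rewrite fE [aug_d _ _ _]cone_dE.
change (al q + be z =
  k0 (bdry k.+1 q *~ sg + cap ec k.+1 z) *~ sg + h (bdry k.+1 q *~ sg + cap ec k.+1 z) -
  g (- bdry (k + m.+2) z)).
rewrite homN opprK !homD !homMz hz mul0rz add0r mulrzDl mzK -k0E -!addrA.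
congr (_ + _); rewrite -gE; change (be z = k0 (cap ec k.+1 z) *~ sg +
  (be z - k0 (cap ec k.+1 z) *~ sg)).
by rewrite addrC subrK.
Qed.
End ExtensionOfCocycle.

Section ExtensionOfPeriodicity.
Variables (p : nat) (p_pr : prime p) (G : groupType) (w : padic_char p G).
Hypothesis w1 : trivial_modp w.

Section CapOfCup.
Variables (n : nat) (a : cochain n G (Zp_twist w)).
Hypotheses (ea : equivariant a) (da : delta a = 0).
Variable N : rgMod 'F_p G.

Lemma fp_scaleE (r : 'F_p) (x : N) : r *: x = x *+ r.
Proof. by rewrite -[r in LHS]natr_Zp scaler_nat. Qed.

Fact fp_kill (x : rg_zg N) : x *+ p ^ 1 = 0.
Proof. by rewrite expn1 -(scaler_nat p (x : N)) pchar_Fp_0 // scale0r. Qed.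
Definition fp_pt : ptMod p G := PtMod fp_kill.

Let Mp (x : fp_pt) : x *+ p = 0. Proof. by have := fp_kill x; rewrite expn1. Qed.

Fact untwist_subproof : is_zhom (id : pt_twist p_pr fp_pt w -> rg_zg N).
Proof. by split=> // g x; rewrite /= (pt_scale_modp p_pr Mp) w1 mulr1n. Qed.
Fact retwist_subproof : is_zhom (id : rg_zg N -> pt_twist p_pr fp_pt w).
Proof. by split=> // g x; rewrite /= (pt_scale_modp p_pr Mp) w1 mulr1n. Qed.
Let ofT := mk_zhom untwist_subproof.
Let toT := mk_zhom retwist_subproof.

Lemma scale_cup_pt j (f : cochain j G fp_pt) :
  scale_cup (modp_cochain w1 a) (f : cochain j G (rg_zg N)) = cup_cochain p_pr a f.
Proof.
by apply/funext => x; rewrite /cup_cochain (pt_scale_modp p_pr Mp) -fp_scaleE.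
Qed.

Lemma cap_surj_of_cup j : cup_surj p_pr a fp_pt j -> cap_surj (modp_equivariant w1 ea) N j.
Proof.
move=> cs f fz.
have [||f' [h [ef df eh fE]]] := cs (fun y => toT (f (bas y))).
- exact/(zhom_equivariant toT)/hom_equivariant.
- rewrite (zhom_delta toT); apply/funext => y.
  by rewrite -hom_bdry fz.
have eh' : equivariant ((fun x => ofT (h x)) : cochain _ G _) by apply: zhom_equivariant.
exists (@fr_lift _ _ _ N _ ef), (fr_lift eh'); split=> z; move: z.
  apply: (@fr_ext _ _ _ _ (cmph (@fr_lift _ _ _ N _ ef) (bdry _)) zeroh) => y.
  rewrite !homE hom_bdry (_ : (fun z => _) = f').
    by rewrite [LHS](congr1 (@^~ y) df).
  by apply/funext => z; rewrite fr_liftE.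
apply: (@fr_ext _ _ _ _ f (addh (cmph (@fr_lift _ _ _ N _ ef) (cap _ _))
  (cmph (fr_lift eh') (bdry _)))) => y.
rewrite !homE hom_cap hom_bdry.
rewrite (_ : (fun z => fr_lift ef _) = f'); last first.
  by apply/funext => z; rewrite fr_liftE.
rewrite (_ : (fun z => fr_lift eh' _) = (fun x => ofT (h x))); last first.
  by apply/funext => z; rewrite fr_liftE.
rewrite (scale_cup_pt f') zhom_delta; exact: (congr1 (@^~ y) fE).
Qed.

Lemma cap_inj_of_cup j : cup_inj p_pr a fp_pt j -> cap_inj (modp_equivariant w1 ea) N j.
Proof.
move=> ci h g hz hg.
have [||||k ek kE] := ci (fun y => h (bas y)) (fun y => toT (g (bas y))).
- exact: hom_equivariant.
- by apply/funext => y; rewrite -[LHS]hom_bdry hz.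
- exact/(zhom_equivariant toT)/hom_equivariant.
- rewrite (zhom_delta toT) -(scale_cup_pt (fun y => h (bas y))); apply/funext => y.
  by rewrite -(hom_cap (modp_equivariant w1 ea)) hg hom_bdry.
exists (@fr_lift _ _ _ N _ ek); apply: (@fr_ext _ _ _ _ h (cmph (fr_lift _) (bdry j))) => y.
rewrite !homE hom_bdry (_ : (fun z => fr_lift ek _) = k).
  exact: (congr1 (@^~ y) kE).
by apply/funext => z; rewrite fr_liftE.
Qed.
End CapOfCup.

Lemma extension_of_cup_iso m (a : cocycle (Zp_twist w) m.+2) k : cup_iso p_pr a k.+1 ->
  exists (E : extension p G m) (x : cohomology (rg_zg (triv_mod 'F_p G)) m.+2),
    [/\ forall i, (i <= m)%N -> projective (ext_P E i),
        exists d, projdim_le (ext_A E) d, ext_class E x & omega_p_integral w x].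
Proof.
move=> iso; have /asboolP[ea da] := cocycleP a.
pose ec := modp_equivariant w1 ea; pose dc := modp_delta w1 da.
have cP : modp_cochain w1 a \in @cocycle_pred G (rg_zg (triv_mod 'F_p G)) m.+2.
  by apply/asboolP; split.
pose E : extension p G m := @Extension p G m (std 'F_p G) (pushout ec) (pushout_d ec)
  (pushout_in ec) (@std_onto _ _) (fun i _ => @std_exact _ _ i)
  (@pushout_exactP _ _ _ _ ec) (@pushout_exactA _ _ _ _ ec) (@pushout_in_inj _ _ _ _ ec dc).
exists E, (cls (Cocycle cP)); split.
- by move=> i _; apply: std_proj.
- apply: (@pushout_projdim _ _ _ _ ec dc k) => N j kj; have [s i] := iso (fp_pt N) j kj.
  by split; [apply: cap_surj_of_cup | apply: cap_inj_of_cup].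
(* The middle of the extension is the standard resolution, so the comparison map is the identity,
   followed by [pushout_free]; the Yoneda cocycle is the reduction of [a] itself. *)
- exists (fun i => bas), (fun y => pushout_free ec (bas y)), (Cocycle cP).
  split.
  + split=> [i|]; [exact: bas_equivariant | exact: hom_equivariant].
  + by move=> y; rewrite fr_liftE.
  + by move=> i _ y; rewrite [LHS]bdryE.
  + by move=> y; rewrite [LHS]pushout_dE bdryE.
  split=> // y; rewrite -hom_bdry; apply/quo_piP; exists (bas y).
  by rewrite fr_liftE; apply: injective_projections; rewrite /= ?subr0 ?sub0r.
exists w1, (cls a); rewrite cohom_map_cls; congr cls; exact: val_inj.
Qed.

End ExtensionOfPeriodicity.

(** * Powers of a periodicity class *)

Section Powers.
Variables (p : nat) (p_pr : prime p) (G : groupType).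

Lemma cup_iso_power (w : padic_char p G) n (a : cochain n G (Zp_twist w)) k :
  (0 < n)%N -> equivariant a -> delta a = 0 -> cup_iso p_pr a k -> forall N,
  exists (w' : padic_char p G) (n' : nat) (a' : cochain n' G (Zp_twist w')),
    [/\ forall g, w' g = w g ^+ N.+1, (N < n')%N, equivariant a', delta a' = 0
      & cup_iso p_pr a' k].
Proof.
move=> n0 ea da ia; elim=> [|N [w' [n' [a' [w'E Nn' ea' da' ia']]]]].
  by exists w, n, a; split.
exists (prod_char w w'), (n' + n)%N, (prod_cochain a a'); split.
- by move=> g; rewrite exprS -w'E.
- by rewrite -addn1 leq_add.
- exact: prod_equivariant.
- exact: prod_delta.
exact: cup_iso_prod.
Qed.

Lemma padic_modpX (x : padic p) N : padic_modp (x ^+ N) = padic_modp x ^+ N.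
Proof. by elim: N => [|N IHN] //; rewrite !exprS padic_modpM IHN. Qed.

Lemma padic_modp_unit (x : padic p) : x \is a GRing.unit -> padic_modp x ^+ p.-1 = 1.
Proof.
move=> ux; have x0 : padic_modp x != 0.
  apply/eqP => x0; have : padic_modp (x / x) = 1 by rewrite divrr.
  by rewrite padic_modpM x0 mul0r => /esym/eqP; rewrite oner_eq0.
apply: (mulfI x0); rewrite mulr1 -exprS prednK ?prime_gt0 //.
by have := expf_card (padic_modp x); rewrite card_Fp.
Qed.

Lemma triv_char_eq (w : padic_char p G) : (forall g, w g = 1) -> w = triv_char p G.
Proof.
case: w => w wu wM /= w1.
have {}w1 : w = fun=> 1 by apply/funext.
by subst w; congr PadicChar; apply: Prop_irrelevance.
Qed.

(** The clause on [triv_char] serves the untwisted half of the theorem: powers of the trivial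
    character are trivial. *)
Lemma extension_of_periodic (w : padic_char p G) : periodic_via p_pr w ->
  exists w', (w = triv_char p G -> w' = triv_char p G) /\
  exists (m : nat) (E : extension p G m)
         (x : cohomology (rg_zg (triv_mod 'F_p G)) m.+2),
    [/\ forall i, (i <= m)%N -> projective (ext_P E i),
        exists d, projdim_le (ext_A E) d, ext_class E x & omega_p_integral w' x].
Proof.
move=> [k [n [e [k0 n0 bij]]]]; pose a := cls_repr e.
have /asboolP[ea da] := cocycleP a.
have ia : cup_iso p_pr a k by apply: cup_iso_of_bijective; rewrite cls_reprK.
have p2 : (0 < p.-1 * 2)%N by rewrite muln_gt0 -ltnS prednK ?prime_gt0 ?prime_gt1.
(* By Fermat, exponent p - 1 makes the character trivial mod p. The factor 2 secures degree at least
   2 when p = 2 and the class has degree 1. *)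
have [w' [n' [a' [w'E Nn' ea' da' ia']]]] := cup_iso_power n0 ea da ia (p.-1 * 2).-1.
rewrite prednK // in w'E Nn'.
have w1 : trivial_modp w'.
  by move=> g; rewrite w'E padic_modpX exprM padic_modp_unit ?pchar_unit // expr1n.
exists w'; split=> [wt|].
  by apply: triv_char_eq => g; rewrite w'E wt expr1n.
case: n' a' Nn' ea' da' ia' => [|[|m]] a' Nn' ea' da' ia'.
- by move: (leq_trans p2 Nn').
- have : (1 < p.-1 * 2)%N by case: (p.-1) p2 => [|[|q]].
  by move=> h; move: (leq_trans h Nn').
have aP : a' \in @cocycle_pred G (Zp_twist w') m.+2 by apply/asboolP.
have ka : cup_iso p_pr (Cocycle aP) k.-1.+1 by rewrite prednK.
by have [E [x H]] := extension_of_cup_iso w1 ka; exists m, E, x.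
Qed.

End Powers.

(* The length n > 1 of the exact sequences is m.+2. *)
Theorem lemma6p3 (p : nat) (p_pr : prime p) (G : groupType) :
  (twisted_p_periodic p_pr G <->
   exists (m : nat) (E : extension p G m)
          (x : cohomology (rg_zg (triv_mod 'F_p G)) m.+2),
     [/\ forall i, (i <= m)%N -> projective (ext_P E i),
         exists d, projdim_le (ext_A E) d,
         ext_class E x
       & exists w : padic_char p G, omega_p_integral w x])
  /\
  (p_periodic p_pr G <->
   exists (m : nat) (E : extension p G m)
          (x : cohomology (rg_zg (triv_mod 'F_p G)) m.+2),
     [/\ forall i, (i <= m)%N -> projective (ext_P E i),
         exists d, projdim_le (ext_A E) d,
         ext_class E x
       & p_integral x]).
Proof.
split; split.
- move=> [w /extension_of_periodic[w' [_ [m [E [x [pP fA cx ix]]]]]]].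
  by exists m, E, x; split=> //; exists w'.
- move=> [m [E [x [pP fA cx [w ix]]]]]; exists w.
  exact: (periodic_of_extension p_pr pP fA cx ix).
- move=> /extension_of_periodic[w' [/(_ erefl) -> [m [E [x [pP fA cx ix]]]]]].
  by exists m, E, x; split.
- move=> [m [E [x [pP fA cx ix]]]].
  exact: (periodic_of_extension p_pr pP fA cx ix).
Qed.
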